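(* Let $d\ge1$ and let $k$ be an isotropic kernel on $\mathbb S^d$ induced by $\psi\in\Psi_\infty$. Then the following statements are equivalent: (i) $k$ is characteristic. (ii) $k$ is universal. (iii) $k$ is strictly positive definite, that is, $\psi\in\Psi_\infty^+$.
   Context: A kernel on a set $X$ is a symmetric function $k:X\times X\to\mathbb R$ with $\sum_{i,j=1}^na_ia_jk(x_i,x_j)\ge0$ for all $n$, $a_i\in\mathbb R$, $x_i\in X$; it is strictly positive definite if equality implies $a_1=\dots=a_n=0$ whenever $x_1,\dots,x_n$ are mutually distinct. $\mathbb S^d$ is the unit sphere in $\mathbb R^{d+1}$ and $\theta(x,y)=\arccos\langle x,y\rangle$ the geodesic distance on it. For $d\ge1$, $\Psi_d$ is the class of all continuous functions $\psi:[0,\pi]\to\mathbb R$ such that $k(x,y)=\psi(\theta(x,y))$ is a kernel on $\mathbb S^d$ (the isotropic kernel on $\mathbb S^d$ induced by $\psi$); $\Psi_d^+\subset\Psi_d$ is the class of those $\psi$ for which this kernel is strictly positive definite on $\mathbb S^d$. $\Psi_\infty:=\bigcap_{d\ge1}\Psi_d$ and $\Psi_\infty^+:=\bigcap_{d\ge1}\Psi_d^+$. A continuous kernel on $\mathbb S^d$ with reproducing kernel Hilbert space $H$ is universal if $H$ is dense in $C(\mathbb S^d)$ in the supremum norm. A bounded measurable kernel with RKHS $H$ is characteristic if $P\mapsto\int k(\cdot,x)\,\mathrm dP(x)\in H$ (Pettis integral) is injective on the set of Borel probability measures on $\mathbb S^d$. *)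

(* Defs.v *)
From HB Require Import structures.
From mathcomp Require Import all_boot all_order all_algebra.
From mathcomp Require Import all_classical all_reals all_analysis.
Import Order.TTheory GRing.Theory Num.Theory.
Import numFieldTopology.Exports numFieldNormedType.Exports.
Local Open Scope classical_set_scope.
Local Open Scope ring_scope.

Section kernels.
Context {R : realType} {X : Type}.
Implicit Types (k : X -> X -> R) (H : set (X -> R)).

Definition kernel_form k {n : nat} (a : 'I_n -> R) (x : 'I_n -> X) : R :=
  \sum_(i < n) \sum_(j < n) a i * a j * k (x i) (x j).

Definition is_kernel k : Prop :=
  (forall x y, k x y = k y x) /\
  forall (n : nat) (a : 'I_n -> R) (x : 'I_n -> X), 0 <= kernel_form k a x.

Definition strictly_positive_definite k : Prop :=
  is_kernel k /\
  forall (n : nat) (a : 'I_n -> R) (x : 'I_n -> X),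
    injective x -> kernel_form k a x = 0 -> forall i, a i = 0.

(* A Hilbert space of functions on X is given by its set H of elements and an
   inner product ip; the values of ip outside H are irrelevant. *)
Definition ip_norm (ip : (X -> R) -> (X -> R) -> R) (f : X -> R) : R :=
  Num.sqrt (ip f f).

Record hilbert_function_space H (ip : (X -> R) -> (X -> R) -> R) : Prop := {
  hfs_zero : H (fun=> 0) ;
  hfs_linear : forall a f g, H f -> H g -> H (a \*o f \+ g) ;
  hfs_ip_linear : forall a f g h, H f -> H g -> H h ->
    ip (a \*o f \+ g) h = a * ip f h + ip g h ;
  hfs_ip_sym : forall f g, H f -> H g -> ip f g = ip g f ;
  hfs_ip_ge0 : forall f, H f -> 0 <= ip f f ;
  hfs_ip_eq0 : forall f, H f -> ip f f = 0 -> f = (fun=> 0) ;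
  hfs_complete : forall u : nat -> X -> R, (forall n, H (u n)) ->
    (forall e : R, 0 < e -> exists N : nat, forall m n : nat,
      (N <= m)%N -> (N <= n)%N -> ip_norm ip (u m \- u n) < e) ->
    exists2 f, H f & (fun n => ip_norm ip (u n \- f)) @ \oo --> (0 : R)
}.

Record is_rkhs k H (ip : (X -> R) -> (X -> R) -> R) : Prop := {
  rkhs_hilbert : hilbert_function_space H ip ;
  rkhs_mem : forall x, H (k^~ x) ;
  rkhs_reproducing : forall f x, H f -> f x = ip f (k^~ x)
}.

End kernels.

(* In universal and characteristic, "exists H ip, is_rkhs k H ip" stands for "with
   H the RKHS of k": by the Moore-Aronszajn theorem every kernel has exactly
   one RKHS. *)

Definition universal {R : realType} {X : topologicalType} (k : X -> X -> R)
    : Prop :=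
  continuous (fun p : X * X => k p.1 p.2) /\
  exists H ip, [/\ is_rkhs k H ip,
    H `<=` [set f : X -> R | continuous f] &
    forall f : X -> R, continuous f -> forall e : R, 0 < e ->
      exists2 g, H g & forall x, `|f x - g x| < e].

Definition borel (X : ptopologicalType) := g_sigma_algebraType (@open X).

(* m is the Pettis integral of F : X -> H with respect to P, the continuous
   linear functionals on H being the maps ip f with f in H. *)
Definition is_pettis_integral {R : realType} {d : measure_display}
    {T : measurableType d} {X : Type} (H : set (X -> R))
    (ip : (X -> R) -> (X -> R) -> R) (P : probability T R)
    (F : T -> X -> R) (m : X -> R) : Prop :=
  H m /\
  forall f, H f ->
    P.-integrable setT (EFin \o (fun x => ip f (F x))) /\
    (ip f m)%:E = (\int[P]_x (ip f (F x))%:E)%E.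

(* Equality of probability measures is equality on measurable sets: the
   underlying set function of a probability is unconstrained elsewhere. *)
Definition characteristic {R : realType} {X : ptopologicalType}
    (k : X -> X -> R) : Prop :=
  [/\ exists C : R, forall x y, `|k x y| <= C,
    measurable_fun setT (fun p : borel X * borel X => k p.1 p.2 : R) &
    exists H ip, is_rkhs k H ip /\
      exists Phi : probability (borel X) R -> X -> R,
        (forall P, is_pettis_integral H ip P (fun x : borel X => k^~ x) (Phi P)) /\
        forall P Q, Phi P = Phi Q -> forall A, measurable A -> P A = Q A].

Definition dotp {R : realType} {n : nat} (x y : 'rV[R]_n) : R :=
  \sum_(i < n) x ord0 i * y ord0 i.

Definition unit_sphere (R : realType) (d : nat) : set 'rV[R]_d.+1 :=
  [set x | dotp x x = 1].

(* Carries the topology inherited from 'rV[R]_d.+1. *)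
Definition sphere (R : realType) (d : nat) : Type :=
  set_type (unit_sphere R d).

Lemma sphere_north (R : realType) (d : nat) :
  @delta_mx R 1 d.+1 ord0 ord0 \in unit_sphere R d.
Proof.
rewrite inE /unit_sphere /= /dotp (bigD1 ord0) //= !mxE eqxx mulr1.
rewrite big1 ?addr0 // => i /negPf i0.
by rewrite !mxE i0 andbF mulr0.
Qed.

HB.instance Definition _ (R : realType) (d : nat) :=
  PseudoMetric.on (sphere R d).
HB.instance Definition _ (R : realType) (d : nat) :=
  isPointed.Build (sphere R d)
    (exist (fun x => x \in unit_sphere R d) _ (sphere_north R d)).

Definition geodesic {R : realType} {d : nat} (x y : sphere R d) : R :=
  acos (dotp (val x) (val y)).

Definition isotropic {R : realType} (d : nat) (psi : R -> R)
    : sphere R d -> sphere R d -> R :=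
  fun x y => psi (geodesic x y).

(* A function on [0, pi] is represented by any extension psi : R -> R: below,
   only the values of psi on [0, pi] matter. *)
Definition Psi (R : realType) (d : nat) : set (R -> R) :=
  [set psi | {within `[0, pi], continuous psi} /\ is_kernel (isotropic d psi)].

Definition Psi_plus (R : realType) (d : nat) : set (R -> R) :=
  [set psi | Psi R d psi /\ strictly_positive_definite (isotropic d psi)].

Definition Psi_infty (R : realType) : set (R -> R) :=
  \bigcap_(d in [set d | (1 <= d)%N]) Psi R d.

Definition Psi_infty_plus (R : realType) : set (R -> R) :=
  \bigcap_(d in [set d | (1 <= d)%N]) Psi_plus R d.

(* Main.v *)
From HB Require Import structures.
Require Import Defs.
From mathcomp Require Import all_boot all_order all_algebra.
From mathcomp Require Import all_classical all_reals all_analysis.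
From mathcomp Require Import measurable_realfun.
From mathcomp Require Import ring lra.

Set Implicit Arguments.
Unset Strict Implicit.
Unset Printing Implicit Defensive.
Import Order.TTheory GRing.Theory Num.Theory.
Import numFieldTopology.Exports numFieldNormedType.Exports.
Local Open Scope classical_set_scope.
Local Open Scope ring_scope.

(** By Schoenberg's theorem, [psi (acos t)] is a power series [sum_j b_j t^j]
    with [b_j >= 0]: testing positive definiteness on the vertices of the cube
    [{-1,1}^n / sqrt n] shows that its Bernstein polynomials have nonnegative
    coefficients.  Each of the three properties is equivalent to [b_j > 0] for
    infinitely many even and infinitely many odd [j].  If this holds, the RKHS
    contains all monomials of degree [j] with [b_j > 0], hence, as
    [sum_i x_i^2 = 1] on the sphere, all polynomials, which are dense.  If it
    fails, a suitable antipodally (anti)symmetric combination of finitely many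
    Dirac masses on a circle is a nonzero measure of total mass zero that
    annihilates the RKHS. *)

(** The condition on [b] does not mention the dimension, which is how strict positive definiteness
    on one sphere spreads to all of them. Such a [b] exists because [psi] is positive definite on
    spheres of every dimension, so that cubes of every dimension can be tested; its entries are
    limits of Bernstein coefficients along an ultrafilter, and a tail bound stated through finitely
    many coefficients keeps mass from escaping to infinite degree. The RKHS is built without
    completion: [f] belongs to it when [2 <f,u> - |u|^2] is bounded above over finitely supported
    signed measures [u]. Membership is then an inequality between quadratic forms, and comparing the
    kernel with a single term [b_m <x,y>^m] is enough to place monomials in the RKHS. Universality
    and the characteristic property only assert that some RKHS with certain features exists, so
    their consequences are drawn for an arbitrary one, from the reproducing property alone. Both
    approximation theorems, on the segment and on the sphere, average over independent random signs
    with prescribed means and conclude as in Chebyshev's inequality. *)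

Section formal_combinations.
Context {R : realType} {X : Type}.
Implicit Types (f g : X -> R) (u v : seq (R * X)) (k : X -> X -> R).

(** A list of weighted points encodes a finitely supported signed measure. Points may repeat, so
    that concatenation is addition. *)
Definition pairing f u : R := \sum_(p <- u) p.1 * f p.2.

Definition scale_comb (a : R) u : seq (R * X) := [seq (a * p.1, p.2) | p <- u].

Definition kcomb k u : X -> R := fun x => pairing (k x) u.

Definition gram k u v : R := pairing (kcomb k u) v.

Lemma pairing_nil f : pairing f [::] = 0.
Proof. by rewrite /pairing big_nil. Qed.

Lemma pairing_cons f p u : pairing f (p :: u) = p.1 * f p.2 + pairing f u.
Proof. by rewrite /pairing big_cons. Qed.

Lemma pairing_cat f u v : pairing f (u ++ v) = pairing f u + pairing f v.
Proof. by rewrite /pairing big_cat. Qed.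

Lemma pairing_scale f a u : pairing f (scale_comb a u) = a * pairing f u.
Proof.
by rewrite /pairing big_map mulr_sumr; apply: eq_bigr => p _; rewrite mulrA.
Qed.

Lemma pairing_lin a f g u :
  pairing (a \*o f \+ g) u = a * pairing f u + pairing g u.
Proof.
rewrite /pairing mulr_sumr -big_split; apply: eq_bigr => p _ /=; ring.
Qed.

Lemma pairing_sum (I : Type) (r : seq I) (P : pred I) (c : I -> R)
    (F : I -> X -> R) u :
  pairing (fun x => \sum_(i <- r | P i) c i * F i x) u =
  \sum_(i <- r | P i) c i * pairing (F i) u.
Proof.
rewrite /pairing; under eq_bigr do rewrite mulr_sumr.
rewrite exchange_big; apply: eq_bigr => i _; rewrite mulr_sumr.
by apply: eq_bigr => p _; rewrite mulrCA.
Qed.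

Lemma eq_pairing f g u : f =1 g -> pairing f u = pairing g u.
Proof. by move=> fg; apply: eq_bigr => p _; rewrite fg. Qed.

Lemma gramE k u v :
  gram k u v = \sum_(q <- v) \sum_(p <- u) q.1 * (p.1 * k q.2 p.2).
Proof.
by apply: eq_bigr => q _; rewrite /kcomb /pairing mulr_sumr.
Qed.

Lemma gram_sym k u v : (forall x y, k x y = k y x) -> gram k u v = gram k v u.
Proof.
move=> ks; rewrite !gramE exchange_big; apply: eq_bigr => p _.
by apply: eq_bigr => q _; rewrite ks mulrCA.
Qed.

Lemma kcomb_cat k u v : kcomb k (u ++ v) = kcomb k u \+ kcomb k v.
Proof. by apply/funext => x; rewrite /kcomb pairing_cat. Qed.

Lemma kcomb_scale k a u : kcomb k (scale_comb a u) = a \*o kcomb k u.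
Proof. by apply/funext => x; rewrite /kcomb pairing_scale. Qed.

Lemma gram_ge0 k u : is_kernel k -> 0 <= gram k u u.
Proof.
move=> [ks kp].
have := kp (size u) (fun i => (tnth (in_tuple u) i).1)
  (fun i => (tnth (in_tuple u) i).2).
rewrite /kernel_form gramE (big_tnth _ _ u) => /le_trans; apply.
rewrite le_eqVlt; apply/orP; left; apply/eqP; apply: eq_bigr => i _.
rewrite (big_tnth _ _ u); apply: eq_bigr => j _.
by rewrite mulrA.
Qed.

End formal_combinations.

(** * Construction of the RKHS of a kernel *)

Section reproducing_kernel_hilbert_space.
Context {R : realType} {X : Type}.
Variable k : X -> X -> R.
Hypothesis kk : is_kernel k.
Implicit Types (f g h : X -> R) (u v : seq (R * X)).

Let ksym x y : k x y = k y x. Proof. by case: kk. Qed.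

(* Its supremum over [u] is the square of the norm of [f]. *)
Definition rkhs_obj f u : R := 2 * pairing f u - gram k u u.

Definition rkhs : set (X -> R) := [set f | has_ubound (range (rkhs_obj f))].

Definition rkhs_sqnorm f : R := sup (range (rkhs_obj f)).

(** Polarization. The norm is defined as a supremum, so bilinearity is not automatic and is
    recovered by approximation. *)
Definition rkhs_ip f g : R := (rkhs_sqnorm (f \+ g) - rkhs_sqnorm (f \- g)) / 4.

Local Notation N := rkhs_sqnorm.

Lemma rkhs_obj_le f u : rkhs f -> rkhs_obj f u <= N f.
Proof. by move=> Hf; apply: ub_le_sup => //; exists u. Qed.

Lemma rkhs_bounded f C : (forall u, rkhs_obj f u <= C) -> rkhs f.
Proof. by move=> fC; exists C => _ [u _ <-]. Qed.

Lemma rkhs_sqnorm_le f C : (forall u, rkhs_obj f u <= C) -> N f <= C.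
Proof.
move=> fC; apply: ge_sup => [|_ [u _ <-] //].
by exists (rkhs_obj f [::]), [::].
Qed.

Lemma rkhs_sqnorm_ge0 f : rkhs f -> 0 <= N f.
Proof.
move=> /(@rkhs_obj_le _ [::]).
by rewrite /rkhs_obj /gram !pairing_nil mulr0 subr0.
Qed.

Lemma gram_cat_scale a u v : gram k (u ++ scale_comb a v) (u ++ scale_comb a v) =
  gram k u u + 2 * a * gram k u v + a ^+ 2 * gram k v v.
Proof.
rewrite /gram pairing_cat pairing_scale kcomb_cat kcomb_scale.
rewrite -/(gram k _ _) -[X in X \+ _](_ : 1 \*o kcomb k u = _); last first.
  by apply/funext => x /=; rewrite mul1r.
have -> : 1 \*o kcomb k u \+ a \*o kcomb k v = a \*o kcomb k v \+ kcomb k u.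
  by apply/funext => x /=; rewrite mul1r addrC.
rewrite !pairing_lin -!/(gram k _ _) (gram_sym v u ksym); ring.
Qed.

Lemma gram_scale a u : gram k (scale_comb a u) (scale_comb a u) =
  a ^+ 2 * gram k u u.
Proof.
have := gram_cat_scale a [::] u; rewrite cat0s => ->.
rewrite [gram k [::] u]gram_sym // /gram !pairing_nil; ring.
Qed.

Lemma pairing_add f g u : pairing (f \+ g) u = pairing f u + pairing g u.
Proof.
by rewrite /pairing -big_split; apply: eq_bigr => p _; rewrite mulrDr.
Qed.

(** Completing the square: translating the function by [kcomb k v] translates the argument by [-v],
    up to a constant. *)
Lemma rkhs_obj_add_kcomb f v u :
  rkhs_obj (f \+ kcomb k v) u =
  rkhs_obj f (u ++ scale_comb (-1) v) + (2 * pairing f v + gram k v v).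
Proof.
rewrite /rkhs_obj pairing_add -/(gram k v u) gram_cat_scale pairing_cat.
rewrite pairing_scale (gram_sym v u ksym); ring.
Qed.

Lemma rkhs_add_kcomb f v : rkhs f -> rkhs (f \+ kcomb k v).
Proof.
move=> Hf.
apply: (@rkhs_bounded _ (N f + (2 * pairing f v + gram k v v))) => u.
by rewrite rkhs_obj_add_kcomb lerD2r; apply: rkhs_obj_le.
Qed.

Lemma rkhs_sqnorm_add_kcomb f v : rkhs f ->
  N (f \+ kcomb k v) = N f + (2 * pairing f v + gram k v v).
Proof.
move=> Hf; apply/eqP; rewrite eq_le; apply/andP; split.
  apply: rkhs_sqnorm_le => u.
  by rewrite rkhs_obj_add_kcomb lerD2r; apply: rkhs_obj_le.
rewrite -lerBrDr; apply: rkhs_sqnorm_le => u; rewrite lerBrDr.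
(* At [u ++ v] the translation by [-v] gives back [u]: the lists differ, but they define the same
   functional. *)
have := rkhs_obj_le (u ++ v) (rkhs_add_kcomb v Hf).
apply: le_trans; rewrite rkhs_obj_add_kcomb lerD2r /rkhs_obj.
have -> : pairing f ((u ++ v) ++ scale_comb (-1) v) = pairing f u.
  by rewrite !pairing_cat pairing_scale; ring.
rewrite lerB // /gram.
have -> : kcomb k ((u ++ v) ++ scale_comb (-1) v) = kcomb k u.
  apply/funext => x; rewrite /kcomb !pairing_cat pairing_scale; ring.
by rewrite !pairing_cat pairing_scale; lra.
Qed.

Lemma rkhs0 : rkhs (fun=> 0).
Proof.
apply: (@rkhs_bounded _ 0) => u; rewrite /rkhs_obj /pairing big1 => [|p _].
  by rewrite mulr0 sub0r oppr_le0 gram_ge0.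
by rewrite mulr0.
Qed.

Lemma rkhs_sqnorm0 : N (fun=> 0) = 0.
Proof.
apply/eqP; rewrite eq_le rkhs_sqnorm_ge0 ?andbT; last exact: rkhs0.
apply: rkhs_sqnorm_le => u; rewrite /rkhs_obj /pairing big1 => [|p _].
  by rewrite mulr0 sub0r oppr_le0 gram_ge0.
by rewrite mulr0.
Qed.

Lemma add0f f : (fun=> 0) \+ f = f.
Proof. by apply/funext => x /=; rewrite add0r. Qed.

Lemma rkhs_kcomb u : rkhs (kcomb k u).
Proof. by rewrite -[kcomb k u]add0f; apply: rkhs_add_kcomb; apply: rkhs0. Qed.

Lemma rkhs_sqnorm_kcomb u : N (kcomb k u) = gram k u u.
Proof.
rewrite -[kcomb k u]add0f rkhs_sqnorm_add_kcomb; last exact: rkhs0.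
rewrite rkhs_sqnorm0 /pairing big1 => [|p _]; first by rewrite mulr0 !add0r.
by rewrite mulr0.
Qed.

(** The two multiples of [u] add up to [u], and their weighted quadratic terms to that of [u]. The
    resulting bound, with factors [1 + s] and [1 + s^-1], replaces the triangle inequality before an
    inner product is available. *)
Lemma rkhs_obj_add s f g u : 0 < s ->
  rkhs_obj (f \+ g) u =
  (1 + s) * rkhs_obj f (scale_comb (1 + s)^-1 u) +
  (1 + s^-1) * rkhs_obj g (scale_comb (s / (1 + s)) u).
Proof.
move=> s0; rewrite /rkhs_obj pairing_add !pairing_scale !gram_scale.
have s1 : 1 + s != 0 by rewrite gt_eqF // addr_gt0.
by field; rewrite s1 gt_eqF.
Qed.

Lemma rkhs_sqnorm_add s f g : 0 < s -> rkhs f -> rkhs g ->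
  N (f \+ g) <= (1 + s) * N f + (1 + s^-1) * N g.
Proof.
move=> s0 Hf Hg; apply: rkhs_sqnorm_le => u; rewrite (rkhs_obj_add _ _ _ s0).
by rewrite lerD // ler_pM2l ?rkhs_obj_le // addr_gt0 // invr_gt0.
Qed.

Lemma rkhs_add f g : rkhs f -> rkhs g -> rkhs (f \+ g).
Proof.
move=> Hf Hg; apply: (@rkhs_bounded _ ((1 + 1) * N f + (1 + 1^-1) * N g)) => u.
rewrite (rkhs_obj_add _ _ _ ltr01).
by rewrite lerD // ler_pM2l ?rkhs_obj_le // addr_gt0 // invr_gt0.
Qed.

Lemma rkhs_obj_scale a f u : a != 0 ->
  rkhs_obj (a \*o f) u = a ^+ 2 * rkhs_obj f (scale_comb a^-1 u).
Proof.
move=> a0; rewrite /rkhs_obj pairing_scale gram_scale.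
rewrite -[a \*o f](_ : a \*o f \+ (0 \*o f \+ (fun=> 0)) = _); last first.
  by apply/funext => x /=; rewrite mul0r !addr0.
rewrite !pairing_lin /pairing [X in _ + (_ + X)]big1; last first.
  by move=> p _; rewrite mulr0.
by field.
Qed.

Lemma rkhs_scale a f : rkhs f -> rkhs (a \*o f).
Proof.
move=> Hf; have [->|a0] := eqVneq a 0.
  rewrite [X in rkhs X](_ : _ = fun=> 0); first exact: rkhs0.
  by apply/funext => x /=; rewrite mul0r.
apply: (@rkhs_bounded _ (a ^+ 2 * N f)) => u; rewrite rkhs_obj_scale //.
by rewrite ler_wpM2l ?sqr_ge0 ?rkhs_obj_le.
Qed.

Lemma rkhs_lin a f g : rkhs f -> rkhs g -> rkhs (a \*o f \+ g).
Proof. by move=> Hf Hg; apply: rkhs_add => //; apply: rkhs_scale. Qed.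

Lemma rkhs_sqnorm_scale a f : a != 0 -> rkhs f -> N (a \*o f) = a ^+ 2 * N f.
Proof.
have le b h : b != 0 -> rkhs h -> N (b \*o h) <= b ^+ 2 * N h.
  move=> b0 Hh; apply: rkhs_sqnorm_le => u; rewrite rkhs_obj_scale //.
  by rewrite ler_wpM2l ?sqr_ge0 ?rkhs_obj_le.
move=> a0 Hf; apply/eqP; rewrite eq_le le //=.
have {1}-> : f = a^-1 \*o (a \*o f).
  by apply/funext => x /=; rewrite mulKf.
rewrite mulrC -ler_pdivlMr ?exprn_even_gt0 // mulrC -exprVn.
by apply: le; rewrite ?invr_eq0 //; apply: rkhs_scale.
Qed.

Lemma rkhs_sub f g : rkhs f -> rkhs g -> rkhs (f \- g).
Proof.
move=> Hf Hg; rewrite (_ : f \- g = (-1) \*o g \+ f); first exact: rkhs_lin.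
by apply/funext => x /=; rewrite mulN1r addrC.
Qed.

Lemma rkhs_sqnorm_subC f g : rkhs f -> rkhs g -> N (f \- g) = N (g \- f).
Proof.
move=> Hf Hg; rewrite (_ : f \- g = (-1) \*o (g \- f)).
  by rewrite rkhs_sqnorm_scale ?oppr_eq0 ?oner_eq0 ?sqrrN ?expr1n ?mul1r //;
    apply: rkhs_sub.
by apply/funext => x /=; rewrite mulN1r opprB.
Qed.

Lemma rkhs_approx f e : rkhs f -> 0 < e ->
  exists u, N (f \- kcomb k u) <= e.
Proof.
move=> Hf e0.
have hs : has_sup (range (rkhs_obj f)).
  by split=> //; exists (rkhs_obj f [::]), [::].
have [_ [u _ <-] fu] := sup_adherent e0 hs.
exists u; rewrite (_ : f \- kcomb k u = f \+ kcomb k (scale_comb (-1) u)).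
  rewrite rkhs_sqnorm_add_kcomb // gram_scale pairing_scale.
  move: fu; rewrite /rkhs_obj -/(N f); lra.
by apply/funext => x; rewrite kcomb_scale /= mulN1r.
Qed.

Lemma rkhs_sqnorm_cont f e : rkhs f -> 0 < e ->
  exists2 dl, 0 < dl & forall g, rkhs g -> N g <= dl -> `|N (f \+ g) - N f| <= e.
Proof.
move=> Hf e0; have n0 := rkhs_sqnorm_ge0 Hf.
(* The factor [1 + s] may cost [e / 2], the term with [1 + s^-1] only [e / 4]. The cap [dl <= 1]
   gives the crude bound [N (f \+ g) <= 2 * N f + 2] needed in the lower estimate. *)
pose s := Num.min 1 (e / (4 * (N f + 1))).
have d0 : 0 < 4 * (N f + 1) by lra.
have s0 : 0 < s by rewrite lt_min ltr01 divr_gt0.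
have s1 : s <= 1 by rewrite ge_min lexx.
have se : s * (4 * (N f + 1)) <= e.
  by rewrite -ler_pdivlMr // ge_min lexx orbT.
have i0 : 0 < 1 + s^-1 by rewrite addr_gt0 // invr_gt0.
pose dl := Num.min 1 (e / (4 * (1 + s^-1))).
have p0 : 0 < 4 * (1 + s^-1) by lra.
have l0 : 0 < dl by rewrite lt_min ltr01 divr_gt0.
have l1 : dl <= 1 by rewrite ge_min lexx.
have le : dl * (4 * (1 + s^-1)) <= e.
  by rewrite -ler_pdivlMr // ge_min lexx orbT.
exists dl => // g Hg gl; have g0 := rkhs_sqnorm_ge0 Hg.
have Hfg := rkhs_add Hf Hg.
have A := rkhs_sqnorm_add s0 Hf Hg.
have A1 := rkhs_sqnorm_add ltr01 Hf Hg.
have B : N f <= (1 + s) * N (f \+ g) + (1 + s^-1) * N g.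
  have Hg' : rkhs ((-1) \*o g) by apply: rkhs_scale.
  have := rkhs_sqnorm_add s0 Hfg Hg'.
  rewrite rkhs_sqnorm_scale ?oppr_eq0 ?oner_eq0 // sqrrN expr1n mul1r.
  rewrite [X in N X](_ : _ = f) //.
  by apply/funext => x /=; rewrite mulN1r addrK.
have C : (1 + s^-1) * N g <= e / 4.
  have : (1 + s^-1) * N g <= (1 + s^-1) * dl by rewrite ler_pM2l.
  lra.
rewrite invr1 in A1.
rewrite ler_norml; apply/andP; split; last by nra.
have : s * N (f \+ g) <= s * (2 * N f + 2) by rewrite ler_pM2l //; lra.
nra.
Qed.

Lemma rkhs_ip_kcomb f v : rkhs f -> rkhs_ip f (kcomb k v) = pairing f v.
Proof.
move=> Hf; rewrite /rkhs_ip (_ : f \- _ = f \+ kcomb k (scale_comb (-1) v)).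
  by rewrite !rkhs_sqnorm_add_kcomb // gram_scale pairing_scale; field.
by apply/funext => x; rewrite kcomb_scale /= mulN1r.
Qed.

Lemma rkhs_ip_cont f h e : rkhs f -> rkhs h -> 0 < e ->
  exists2 dl, 0 < dl & forall v, N (h \- kcomb k v) <= dl ->
    `|rkhs_ip f h - pairing f v| <= e.
Proof.
move=> Hf Hh e0.
have [d1 d10 D1] := rkhs_sqnorm_cont (rkhs_add Hf Hh) e0.
have [d2 d20 D2] := rkhs_sqnorm_cont (rkhs_sub Hf Hh) e0.
exists (Num.min d1 d2) => [|v]; first by rewrite lt_min d10.
rewrite le_min => /andP[v1 v2].
have Hv := rkhs_kcomb v; rewrite -rkhs_ip_kcomb // /rkhs_ip.
have := D1 _ (rkhs_sub Hv Hh); rewrite rkhs_sqnorm_subC // => /(_ v1).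
have := D2 _ (rkhs_sub Hh Hv) v2.
rewrite (_ : f \- h \+ (h \- kcomb k v) = f \- kcomb k v); last first.
  by apply/funext => x /=; rewrite addrA subrK.
rewrite (_ : f \+ h \+ (kcomb k v \- h) = f \+ kcomb k v); last first.
  by apply/funext => x /=; rewrite addrACA addrN addr0 addrC addrC.
rewrite !ler_norml; lra.
Qed.

(** Against a combination of kernel sections the inner product is a [pairing], which is linear. Such
    combinations approximate [h], and a single [v] serves all three inner products. *)
Lemma rkhs_ip_linear a f g h : rkhs f -> rkhs g -> rkhs h ->
  rkhs_ip (a \*o f \+ g) h = a * rkhs_ip f h + rkhs_ip g h.
Proof.
move=> Hf Hg Hh; apply/eqP; rewrite -subr_eq0 -normr_le0.
apply/ler_addgt0Pl => e e0; rewrite addr0.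
pose c := 2 + `|a|; have c0 : 0 < c by rewrite ltr_wpDr.
have ec0 : 0 < e / c by rewrite divr_gt0.
have [d1 d10 D1] := rkhs_ip_cont Hf Hh ec0.
have [d2 d20 D2] := rkhs_ip_cont Hg Hh ec0.
have [d3 d30 D3] := rkhs_ip_cont (rkhs_lin a Hf Hg) Hh ec0.
have m0 : 0 < Num.min d1 (Num.min d2 d3) by rewrite !lt_min d10 d20.
have [v] := rkhs_approx Hh m0.
rewrite !le_min => /and3P[/D1 {}D1 /D2 {}D2 /D3]; rewrite pairing_lin => {}D3.
have -> : rkhs_ip (a \*o f \+ g) h - (a * rkhs_ip f h + rkhs_ip g h) =
  (rkhs_ip (a \*o f \+ g) h - (a * pairing f v + pairing g v)) -
  (a * (rkhs_ip f h - pairing f v)) - (rkhs_ip g h - pairing g v) by ring.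
apply: (le_trans (ler_normB _ _)); apply: (le_trans (lerD (ler_normB _ _) D2)).
rewrite normrM.
have : `|a| * `|rkhs_ip f h - pairing f v| <= `|a| * (e / c).
  by rewrite ler_wpM2l.
have -> : e = e / c * c by rewrite divfK // gt_eqF.
rewrite mulfK ?gt_eqF // /c; lra.
Qed.

Lemma rkhs_ipff f : rkhs f -> rkhs_ip f f = N f.
Proof.
move=> Hf; rewrite /rkhs_ip (_ : f \+ f = 2 \*o f); last first.
  by apply/funext => x /=; rewrite mulr_natl.
rewrite rkhs_sqnorm_scale ?pnatr_eq0 //.
rewrite (_ : f \- f = fun=> 0) ?rkhs_sqnorm0; last first.
  by apply/funext => x /=; rewrite addrN.
by field.
Qed.

(** Cauchy-Schwarz, by testing the bound on multiples [t u]: the best [t] is the pairing divided by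
    the Gram value. If the Gram value is 0, the bound is linear in [t] and forces the pairing to
    vanish. *)
Lemma pairing_sqr_le f u : rkhs f -> pairing f u ^+ 2 <= N f * gram k u u.
Proof.
move=> Hf; have n0 := rkhs_sqnorm_ge0 Hf.
have A t : 2 * t * pairing f u - t ^+ 2 * gram k u u <= N f.
  have := rkhs_obj_le (scale_comb t u) Hf.
  by rewrite /rkhs_obj pairing_scale gram_scale mulrA.
have := gram_ge0 u kk; rewrite le_eqVlt => /orP[/eqP q0|q0].
  rewrite -q0 mulr0; have [->|p0] := eqVneq (pairing f u) 0.
    by rewrite expr0n.
  have := A ((N f + 1) / pairing f u); rewrite -q0 mulr0 subr0.
  by rewrite -mulrA divfK //; lra.
have := A (pairing f u / gram k u u).
rewrite (_ : _ - _ = pairing f u ^+ 2 / gram k u u) ?ler_pdivrMr //.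
by field; rewrite gt_eqF.
Qed.

(** Converse of the previous bound: with [p] the pairing and [q] the Gram value,
    [p^2 <= C q <= ((C + q) / 2)^2], so [2 p - q <= C]. Monomials and kernel means enter the RKHS
    this way. *)
Lemma rkhs_criterion f C : 0 <= C ->
  (forall u, pairing f u ^+ 2 <= C * gram k u u) -> rkhs f.
Proof.
move=> C0 fC; apply: (@rkhs_bounded _ C) => u; rewrite /rkhs_obj.
have := fC u; have := gram_ge0 u kk.
set q := gram _ _ _; set p := pairing _ _ => q0 pq.
rewrite lerBlDr; have [p0|p0] := leP p 0; first by lra.
rewrite -(ler_pXn2r (ltn0Sn 1)) ?nnegrE; [|lra..].
by have := sqr_ge0 (C - q); nra.
Qed.

Lemma pairing1 f x : pairing f [:: (1, x)] = f x.
Proof. by rewrite /pairing big_seq1 mul1r. Qed.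

Lemma rkhs_ptwise f x : rkhs f -> f x ^+ 2 <= N f * k x x.
Proof.
move=> /(pairing_sqr_le [:: (1, x)]).
by rewrite pairing1 /gram pairing1 /kcomb pairing1.
Qed.

Lemma rkhs_complete (u : nat -> X -> R) : (forall n, rkhs (u n)) ->
  (forall e : R, 0 < e -> exists M : nat, forall m n : nat,
      (M <= m)%N -> (M <= n)%N -> ip_norm rkhs_ip (u m \- u n) < e) ->
  exists2 f, rkhs f & (fun n => ip_norm rkhs_ip (u n \- f)) @ \oo --> (0 : R).
Proof.
move=> Hu Cu.
have CN e : 0 < e -> exists M : nat, forall m n : nat,
    (M <= m)%N -> (M <= n)%N -> N (u m \- u n) < e ^+ 2.
  move=> e0; have [M CM] := Cu _ e0; exists M => m n Mm Mn.
  have Hmn := rkhs_sub (Hu m) (Hu n).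
  have := CM m n Mm Mn; rewrite /ip_norm rkhs_ipff //.
  rewrite -(ltr_pXn2r (ltn0Sn 1)) ?nnegrE ?sqrtr_ge0 ?ltW //.
  by rewrite sqr_sqrtr // rkhs_sqnorm_ge0.
have cu x : cvgn (fun n => u n x).
  apply/cauchy_cvgP; apply/cauchy_ballP => e e0.
  have c0 : 0 < k x x + 1.
    by rewrite ltr_wpDl // -[k x x]pairing1 -[pairing _ _](pairing1 (kcomb k [:: (1, x)])) gram_ge0.
  have e'0 : 0 < e / (k x x + 1) by rewrite divr_gt0.
  have [M CM] := CN _ e'0.
  pose A := [set u n x | n in [set n | (M <= n)%N]].
  exists (A, A); first by split; exists M => // n Mn; exists n.
  move=> [_ _] /= [[m Mm <-] [n Mn <-]]; rewrite /ball /=.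
  have Hmn := rkhs_sub (Hu m) (Hu n).
  rewrite -(ltr_pXn2r (ltn0Sn 1)) ?nnegrE ?normr_ge0 ?(ltW e0) //.
  rewrite real_normK ?num_real //; apply: le_lt_trans (rkhs_ptwise x Hmn) _.
  have := CM m n Mm Mn; have := rkhs_sqnorm_ge0 Hmn; set q := N _ => q0 qe.
  have k0 : 0 <= k x x.
    by rewrite -[k x x]pairing1 -[pairing _ _](pairing1 (kcomb k [:: (1, x)])) gram_ge0.
  have -> : e = e / (k x x + 1) * (k x x + 1) by rewrite divfK // gt_eqF.
  rewrite exprMn; apply: (@le_lt_trans _ _ (q * (k x x + 1) ^+ 2)).
    by rewrite ler_wpM2l //; nra.
  by rewrite ltr_pM2r // exprn_gt0.
pose f x := limn (fun n => u n x).
have uf y : (fun n => u n y) @ \oo --> f y by exact: cu.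
have uf' v : (fun n => pairing (u n) v) @ \oo --> pairing f v.
  elim: v => [|p v IH].
    rewrite pairing_nil (_ : (fun _ => _) = fun=> 0); first exact: cvg_cst.
    by apply/funext => n; rewrite pairing_nil.
  rewrite pairing_cons (_ : (fun _ => _) = fun n => p.1 * u n p.2 + pairing (u n) v).
    by apply: cvgD => //; apply: cvgM => //; apply: cvg_cst.
  by apply/funext => n; rewrite pairing_cons.
(* For fixed [v] the objective involves finitely many values of the function, so the Cauchy bound
   survives the pointwise limit in [m]. The supremum over [v] is taken only afterwards. *)
have lim_le e : 0 < e -> exists M, forall n, (M <= n)%N ->
    forall v, rkhs_obj (u n \- f) v <= e ^+ 2.
  move=> e0; have [M CM] := CN _ e0; exists M => n Mn v.
  have sub g h w : pairing (g \- h) w = pairing g w - pairing h w.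
    rewrite (_ : g \- h = (-1) \*o h \+ g) ?pairing_lin ?mulN1r 1?addrC //.
    by apply/funext => x /=; rewrite mulN1r addrC.
  have : (fun m => rkhs_obj (u n \- u m) v) @ \oo --> rkhs_obj (u n \- f) v.
    rewrite /rkhs_obj sub; under eq_fun do rewrite sub.
    apply: cvgB; last exact: cvg_cst.
    apply: cvgM; first exact: cvg_cst.
    by apply: cvgB; [exact: cvg_cst|exact: uf'].
  move=> /cvg_lim <- //; apply: limr_le.
    apply: is_cvgB; last exact: is_cvg_cst.
    apply: is_cvgM; first exact: is_cvg_cst.
    under eq_fun do rewrite sub.
    by apply: is_cvgB; [exact: is_cvg_cst|apply/cvg_ex; exists (pairing f v)].
  exists M => // m /= Mm; apply: le_trans (ltW (CM n m Mn Mm)).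
  by apply: rkhs_obj_le; apply: rkhs_sub.
have Hf : rkhs f.
  have [M CM] := lim_le _ ltr01.
  have Hd : rkhs (u M \- f) by apply: rkhs_bounded; exact: CM.
  rewrite (_ : f = u M \- (u M \- f)); first exact: rkhs_sub.
  by apply/funext => x /=; rewrite subKr.
exists f => //; apply/cvgr0Pnorm_lt => e e0.
have e20 : 0 < e / 2 by lra.
have [M CM] := lim_le _ e20; exists M => // n /= Mn.
have Hd := rkhs_sub (Hu n) Hf.
rewrite /ip_norm rkhs_ipff // ger0_norm ?sqrtr_ge0 //.
rewrite -(ltr_pXn2r (ltn0Sn 1)) ?nnegrE ?sqrtr_ge0 ?ltW //.
rewrite sqr_sqrtr ?rkhs_sqnorm_ge0 //.
apply: (@le_lt_trans _ _ ((e / 2) ^+ 2)).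
  by apply: rkhs_sqnorm_le; exact: CM.
by rewrite ltr_pXn2r ?nnegrE ?(ltW e0) ?(ltW e20) //; lra.
Qed.

Theorem moore_aronszajn : is_rkhs k rkhs rkhs_ip.
Proof.
have kE x : k^~ x = kcomb k [:: (1, x)].
  by apply/funext => y; rewrite /kcomb pairing1.
split; [split| |].
- exact: rkhs0.
- exact: rkhs_lin.
- exact: rkhs_ip_linear.
- move=> f g Hf Hg; rewrite /rkhs_ip rkhs_sqnorm_subC //; congr ((N _ - _) / _).
  by apply/funext => x /=; rewrite addrC.
- by move=> f Hf; rewrite rkhs_ipff // rkhs_sqnorm_ge0.
- move=> f Hf; rewrite rkhs_ipff // => N0; apply/funext => x.
  have := rkhs_ptwise x Hf; rewrite N0 mul0r => fx0.
  by apply/eqP; rewrite -sqrf_eq0 eq_le fx0 sqr_ge0.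
- exact: rkhs_complete.
- by move=> x; rewrite kE; exact: rkhs_kcomb.
- by move=> f x Hf; rewrite kE rkhs_ip_kcomb // pairing1.
Qed.

End reproducing_kernel_hilbert_space.

(** * Averages over independent random signs *)

Section rademacher.
Context {R : realType} {I : finType}.
Implicit Types (t c : I -> R) (h : {ffun I -> bool}).

(** The probability of the signs [(-1) ^+ h i] when they are independent with means [t i]. Being
    polynomial in [t], it generates Bernstein operators. *)
Definition rademacher_weight t h : R :=
  \prod_i ((1 + t i * (-1) ^+ h i) / 2).

Lemma sum_prod_bool (F : I -> bool -> R) :
  \sum_(h : {ffun I -> bool}) \prod_i F i (h i) =
  \prod_i (F i true + F i false).
Proof.
by rewrite -bigA_distr_bigA; apply: eq_bigr => i _; rewrite big_bool.
Qed.

Lemma rademacher_weight_ge0 t h : (forall i, `|t i| <= 1) ->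
  0 <= rademacher_weight t h.
Proof.
move=> t1; apply: prodr_ge0 => i _; have := t1 i; rewrite ler_norml.
by case: (h i); rewrite /= ?expr1 ?expr0; lra.
Qed.

Lemma rademacher_weight_sum t : \sum_h rademacher_weight t h = 1.
Proof.
rewrite (sum_prod_bool (fun i b => (1 + t i * (-1) ^+ b) / 2)).
by rewrite big1 // => i _; rewrite expr1 expr0; field.
Qed.

Lemma rademacher_covariance t i j :
  \sum_h rademacher_weight t h * (((-1) ^+ h i - t i) * ((-1) ^+ h j - t j)) =
  (1 - t i ^+ 2) *+ (i == j).
Proof.
(* Written as products over all indices, the factors merge with the weight, and the sum over [h]
   splits into one-coordinate sums. *)
pose G i l (b : bool) : R := if l == i then (-1) ^+ b - t i else 1.
have GE i' h : (-1) ^+ h i' - t i' = \prod_l G i' l (h l).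
  by rewrite (bigD1 i') //= /G eqxx big1 ?mulr1 // => l /negPf ->.
under eq_bigr do rewrite !GE -!big_split /=.
rewrite (sum_prod_bool (fun l b => (1 + t l * (-1) ^+ b) / 2 * (G i l b * G j l b))).
rewrite (bigD1 i) //= /G eqxx expr1 expr0; case: eqVneq => [->|ij].
  rewrite big1 => [|l /negPf li]; first by rewrite mulr1n; field.
  by rewrite li; field.
by rewrite (_ : _ + _ = 0) ?mul0r ?mulr0n //; field.
Qed.

Lemma rademacher_variance t c :
  \sum_h rademacher_weight t h * (\sum_i c i * ((-1) ^+ h i - t i)) ^+ 2 =
  \sum_i c i ^+ 2 * (1 - t i ^+ 2).
Proof.
have E h : rademacher_weight t h * (\sum_i c i * ((-1) ^+ h i - t i)) ^+ 2 =
    \sum_i \sum_j c i * c j *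
      (rademacher_weight t h * (((-1) ^+ h i - t i) * ((-1) ^+ h j - t j))).
  rewrite expr2 mulr_suml mulr_sumr; apply: eq_bigr => i _.
  by rewrite !mulr_sumr; apply: eq_bigr => j _; ring.
rewrite (eq_bigr _ (fun h _ => E h)).
rewrite exchange_big; apply: eq_bigr => i _.
rewrite exchange_big (bigD1 i) //= [X in _ + X]big1 => [|j /negPf ij].
  by rewrite -mulr_sumr rademacher_covariance eqxx addr0 -expr2.
by rewrite -mulr_sumr rademacher_covariance eq_sym ij mulr0n mulr0.
Qed.

(** The averaging step of Bernstein's proof: [dev] will be a squared distance to the mean, [e] the
    error near the mean, and [K * dev] a bound for the error far from it. *)
Lemma rademacher_mean_close t (F dev : {ffun I -> bool} -> R) y e K v :
  (forall i, `|t i| <= 1) -> 0 <= K ->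
  (forall h, `|F h - y| <= e + K * dev h) ->
  \sum_h rademacher_weight t h * dev h <= v ->
  `|\sum_h rademacher_weight t h * F h - y| <= e + K * v.
Proof.
move=> t1 K0 Fy dv; rewrite -[y]mul1r -(rademacher_weight_sum t) mulr_suml.
rewrite -sumrB; apply: (le_trans (ler_norm_sum _ _ _)).
apply: (@le_trans _ _ (\sum_h rademacher_weight t h * (e + K * dev h))).
  apply: ler_sum => h _; rewrite -mulrBr normrM ger0_norm ?rademacher_weight_ge0 //.
  by rewrite ler_wpM2l ?rademacher_weight_ge0.
under eq_bigr do rewrite mulrDr mulrCA.
rewrite big_split /= -mulr_suml rademacher_weight_sum mul1r lerD2l -mulr_sumr.
by rewrite ler_wpM2l.
Qed.

End rademacher.

Lemma cvg_sum {R : realType} {T I : Type} {F : set_system T} {FF : Filter F}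
    (r : seq I) (P : pred I) (g : I -> T -> R) (l : I -> R) :
  (forall i, P i -> g i x @[x --> F] --> l i) ->
  \sum_(i <- r | P i) g i x @[x --> F] --> \sum_(i <- r | P i) l i.
Proof. by move=> gl; apply: cvg_big => //; exact: add_continuous. Qed.

Lemma ultra_fmap (T T' : Type) (g : T -> T') (U : set_system T) :
  UltraFilter U -> UltraFilter (g @ U).
Proof.
move=> UU; have PU := @ultra_proper _ _ UU.
split=> [|G PG UG]; first exact: fmap_proper_filter.
apply/seteqP; split=> // A GA; have [//|UA] := in_ultra_setVsetC (g @^-1` A) UU.
have GA' : G (~` A) by apply: UG.
have : G (A `&` ~` A) by apply: filterI.
by rewrite setICr => /filter_not_empty.
Qed.

(** * Nonnegative power series from positive definiteness on cubes *)

Section schoenberg_series.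
Context {R : realType}.
Variable f : R -> R.
Hypothesis fc : continuous f.

(** The inner product of two vertices of the normalized cube is the [sign_mean] of their
    coordinatewise product. *)
Definition sign_mean n (h : {ffun 'I_n -> bool}) : R :=
  n%:R^-1 * \sum_i (-1) ^+ h i.

Definition sign_mul n (h h' : {ffun 'I_n -> bool}) : {ffun 'I_n -> bool} :=
  [ffun i => h i (+) h' i].

(** The vertices lie on the sphere of dimension [n - 1], which has to be at least 1. *)
Hypothesis fpd : forall n, (1 < n)%N -> forall a : {ffun 'I_n -> bool} -> R,
  0 <= \sum_h \sum_h' a h * a h' * f (sign_mean (sign_mul h h')).

(** The characters of the group of sign vectors, indexed by subsets [s] of the coordinates. *)
Definition walsh n (s h : {ffun 'I_n -> bool}) : R :=
  \prod_i (if s i then (-1) ^+ h i else 1).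

Lemma walsh_mul n (s h h' : {ffun 'I_n -> bool}) :
  walsh s (sign_mul h h') = walsh s h * walsh s h'.
Proof.
rewrite -big_split; apply: eq_bigr => i _ /=; rewrite ffunE.
by case: (s i); rewrite ?mulr1 // signr_addb.
Qed.

Lemma sign_mulK n (h h' : {ffun 'I_n -> bool}) :
  sign_mul h (sign_mul h h') = h'.
Proof. by apply/ffunP => i; rewrite !ffunE addKb. Qed.

Definition walsh_coef n (s : {ffun 'I_n -> bool}) : R :=
  (2 ^+ n)^-1 * \sum_h f (sign_mean h) * walsh s h.

(** Bochner's argument: with a character as weights, translation invariance gives every row of the
    double sum the same value, a positive multiple of the Fourier coefficient. *)
Lemma walsh_coef_ge0 n (s : {ffun 'I_n -> bool}) : (1 < n)%N ->
  0 <= walsh_coef s.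
Proof.
move=> n1; have := fpd n1 (walsh s).
rewrite (eq_bigr (fun=> \sum_h f (sign_mean h) * walsh s h)) => [|h _].
  rewrite sumr_const card_ffun card_bool card_ord /walsh_coef => h.
  rewrite mulr_ge0 ?invr_ge0 ?exprn_ge0 //.
  by move: h; rewrite pmulrn_lge0 // expn_gt0.
rewrite [RHS](reindex_inj (can_inj (sign_mulK h))) /=.
by apply: eq_bigr => h' _; rewrite -walsh_mul mulrC.
Qed.

Definition bernstein n (t : R) : R :=
  \sum_h rademacher_weight (fun=> t) h * f (sign_mean (h : {ffun 'I_n -> bool})).

(** For independent signs of mean [t], the character [s] has mean [t] to the power of the size of
    [s]. Nonnegative Fourier coefficients thus become nonnegative polynomial coefficients. *)
Lemma bernstein_walsh n t : bernstein n t =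
  \sum_(s : {ffun 'I_n -> bool}) walsh_coef s * t ^+ (\sum_i s i).
Proof.
have wE (h : {ffun 'I_n -> bool}) : rademacher_weight (fun=> t) h =
    \sum_(s : {ffun 'I_n -> bool}) (2 ^+ n)^-1 * (walsh s h * t ^+ (\sum_i s i)).
  rewrite -mulr_sumr /rademacher_weight big_split /= prodr_const card_ord exprVn mulrC.
  congr (_ * _); rewrite -(eq_bigr _ (fun i _ => addrC _ _)).
  rewrite -(sum_prod_bool (fun i b => if b then t * (-1) ^+ h i else 1)).
  apply: eq_bigr => s _; rewrite -prodrXr -big_split; apply: eq_bigr => i _ /=.
  by case: (s i); rewrite ?expr1 ?expr0 ?mulr1 // mulrC.
rewrite /bernstein; under eq_bigr do rewrite wE mulr_suml.
rewrite exchange_big; apply: eq_bigr => s _.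
rewrite /walsh_coef mulr_sumr mulr_suml; apply: eq_bigr => h _; ring.
Qed.

Definition bernstein_coef n (j : nat) : R :=
  \sum_(s : {ffun 'I_n -> bool} | (\sum_i s i)%N == j) walsh_coef s.

Lemma bernstein_coef_ge0 n j : (1 < n)%N -> 0 <= bernstein_coef n j.
Proof. by move=> n1; apply: sumr_ge0 => s _; apply: walsh_coef_ge0. Qed.

Lemma bernsteinE n t :
  bernstein n t = \sum_(j < n.+1) bernstein_coef n j * t ^+ j.
Proof.
have sn (s : {ffun 'I_n -> bool}) : (\sum_i s i < n.+1)%N.
  rewrite ltnS -[X in (_ <= X)%N]muln1 -[X in (_ <= X * _)%N](card_ord n).
  by rewrite -sum_nat_const; apply: leq_sum => i _; case: (s i).
rewrite bernstein_walsh (partition_big (fun s => Ordinal (sn s)) xpredT) //=.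
apply: eq_bigr => j _; rewrite mulr_suml; apply: eq_big => [s|s].
  by rewrite -val_eqE.
by move=> /eqP <-.
Qed.

Lemma bernstein1 n : (0 < n)%N -> bernstein n 1 = f 1.
Proof.
move=> n0; rewrite /bernstein (bigD1 [ffun=> false]) //= big1 => [|h h0].
  rewrite /rademacher_weight big1 => [|i _]; last by rewrite ffunE; field.
  rewrite mul1r addr0 /sign_mean; congr f.
  under eq_bigr do rewrite ffunE expr0.
  by rewrite sumr_const card_ord mulVf // pnatr_eq0 -lt0n.
suff [i hi] : exists i, h i.
  by rewrite /rademacher_weight (bigD1 i) //= hi expr1 mul1r subrr !mul0r.
apply/existsP; apply: contraNT h0; rewrite negb_exists => /forallP h0.
by apply/eqP/ffunP => i; rewrite ffunE; apply/negbTE.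
Qed.

Lemma bernstein_coef_sum_le n J : (1 < n)%N ->
  \sum_(j < J) bernstein_coef n j <= f 1.
Proof.
move=> n1; rewrite -(bernstein1 (ltnW n1)) bernstein_walsh.
under [leRHS]eq_bigr do rewrite expr1n mulr1.
rewrite (eq_bigr (fun j : 'I_J => \sum_(s : {ffun 'I_n -> bool})
  if (\sum_i s i == j)%N then walsh_coef s else 0)); last first.
  by move=> j _; rewrite /bernstein_coef big_mkcond.
rewrite exchange_big; apply: ler_sum => s _; rewrite -big_mkcond /=.
have := walsh_coef_ge0 s n1; set m := (\sum_i _)%N => w0.
rewrite sumr_const; case: (ltnP m J) => [mJ|Jm].
  rewrite (_ : #|_| = 1%N) // -(card1 (Ordinal mJ)); apply: eq_card => j.
  by rewrite !inE -val_eqE /= eq_sym.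
rewrite (_ : #|_| = 0%N) ?mulr0n //; apply: eq_card0 => j; rewrite inE /= .
by apply/negbTE/negP => /eqP E; have := ltn_ord j; rewrite -E ltnNge Jm.
Qed.

(** The coefficients from [J] on are nonnegative with sum [f 1] minus the first [J]. Only those
    first [J] enter the bound, so it survives a limit in [n] taken coefficientwise. *)
Lemma bernstein_tail n J t : (1 < n)%N -> `|t| <= 1 ->
  `|bernstein n t - \sum_(j < J) bernstein_coef n j * t ^+ j| <=
  (f 1 - \sum_(j < J) bernstein_coef n j) * `|t| ^+ J.
Proof.
move=> n1 t1.
(* Padding with zero coefficients, since [J] may exceed the degree [n]. *)
pose K := maxn J n.+1.
have big0 j : (n < j)%N -> bernstein_coef n j = 0.
  move=> nj; rewrite /bernstein_coef big_pred0 // => s; apply/negbTE/negP => /eqP E.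
  move: nj; rewrite -E ltnNge -[X in (_ <= X)%N]muln1 -[X in (_ <= X * _)%N](card_ord n).
  by rewrite -sum_nat_const => /negP; apply; apply: leq_sum => i _; case: (s i).
have EK x : bernstein n x = \sum_(0 <= j < K) bernstein_coef n j * x ^+ j.
  rewrite bernsteinE -(big_mkord xpredT (fun j => bernstein_coef n j * x ^+ j)).
  rewrite [RHS](big_cat_nat (n := n.+1)) ?leq_maxr //= [X in _ + X]big_nat [X in _ + X]big1 ?addr0 //.
  by move=> j /andP[nj _]; rewrite big0 ?mul0r.
have split F : \sum_(0 <= j < K) F j - \sum_(j < J) F j = \sum_(J <= j < K) F j :> R.
  by rewrite (big_cat_nat (n := J)) ?leq_maxl //= big_mkord [LHS]addrC addKr.
have -> : f 1 = \sum_(0 <= j < K) bernstein_coef n j.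
  rewrite -(bernstein1 (ltnW n1)) EK; apply: eq_bigr => j _.
  by rewrite expr1n mulr1.
rewrite EK (split (fun j => bernstein_coef n j * t ^+ j)) split.
apply: (le_trans (ler_norm_sum _ _ _)); rewrite mulr_suml.
rewrite big_nat [leRHS]big_nat; apply: ler_sum => j /andP[Jj _].
rewrite normrM ger0_norm ?bernstein_coef_ge0 // normrX.
by rewrite ler_wpM2l ?bernstein_coef_ge0 // ler_wiXn2l.
Qed.

Lemma continuous_segment_bounded (g : R -> R) (a b : R) : a <= b -> continuous g ->
  exists M, forall x, a <= x <= b -> `|g x| <= M.
Proof.
move=> ab gc.
have : {within `[a, b], continuous (fun x => `|g x|)}.
  by apply: continuous_subspaceT => x; apply: continuous_comp; [exact: gc|exact: norm_continuous].
by move=> /(EVT_max ab)[c _ cM]; exists `|g c| => x xab; apply: cM; rewrite in_itv.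
Qed.

Lemma sign_mean_itv n (h : {ffun 'I_n -> bool}) : -1 <= sign_mean h <= 1.
Proof.
rewrite -ler_norml /sign_mean normrM ger0_norm ?invr_ge0 //.
have : `|\sum_i (-1) ^+ h i| <= n%:R :> R.
  apply: (le_trans (ler_norm_sum _ _ _)).
  by under eq_bigr do rewrite normrX normrN1 expr1n; rewrite sumr_const card_ord.
have : 0 <= n%:R :> R by [].
rewrite le_eqVlt => /orP[/eqP <- _|n0 hn]; first by rewrite invr0 mul0r.
by rewrite mulrC ler_pdivrMr // mul1r.
Qed.

Lemma bernstein_cvg t : `|t| <= 1 -> bernstein n t @[n --> \oo] --> f t.
Proof.
move=> t1; have [M fM] : exists M, forall x, -1 <= x <= 1 -> `|f x| <= M.
  by apply: continuous_segment_bounded => //; rewrite lerN10.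
apply/cvgrPdist_le => e e0.
have e20 : 0 < e / 2 by rewrite divr_gt0.
have /cvgrPdist_le /(_ _ e20) [dl /= dl0 fd] := fc (x := t).
have M0 : 0 <= M by apply: le_trans (fM 0 _); rewrite // lerN10 ler01.
(* Where [sign_mean h] is at distance at least [dl] from [t], the term [K * dev h] exceeds the
   trivial bound [2 * M]. *)
pose K := 2 * M / dl ^+ 2.
have K0 : 0 <= K by rewrite divr_ge0 ?sqr_ge0 ?mulr_ge0.
have [N0 _ HN] := nbhs_infty_ger (K / (e / 2)).
exists (maxn 1 N0) => // n /=; rewrite geq_max => /andP[n0 nN].
have n0' : 0 < n%:R :> R by rewrite ltr0n.
have Kn : K * n%:R^-1 <= e / 2.
  by rewrite ler_pdivrMr // mulrC -ler_pdivrMr //; apply: HN.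
rewrite distrC (splitr e); apply: le_trans (_ : e / 2 + K * n%:R^-1 <= _); last first.
  by rewrite lerD2l.
apply: (rademacher_mean_close (dev := fun h => (sign_mean h - t) ^+ 2)) => //.
  move=> h; have [close|far] := ltP `|t - sign_mean h| dl.
    rewrite distrC; apply: (le_trans (fd _ close)); rewrite lerDl.
    by rewrite mulr_ge0 // sqr_ge0.
  apply: (@le_trans _ _ (2 * M)).
    have := fM _ (sign_mean_itv h); have := fM t; rewrite -ler_norml => /(_ t1).
    move=> A B; apply: (le_trans (ler_normB _ _)).
    by rewrite mulr_natl mulr2n lerD.
  rewrite ler_wpDl ?(ltW e20) // /K mulrAC ler_pdivlMr ?exprn_gt0 //.
  rewrite ler_wpM2l ?mulr_ge0 //.
  rewrite -[leRHS]real_normK ?num_real //.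
  by rewrite ler_pXn2r ?nnegrE ?(ltW dl0) // distrC.
have dE (h : {ffun 'I_n -> bool}) :
    sign_mean h - t = \sum_i n%:R^-1 * ((-1) ^+ h i - t).
  rewrite -mulr_sumr sumrB sumr_const card_ord mulrBr -/(sign_mean h).
  by rewrite -[t *+ n]mulr_natl mulKf // gt_eqF.
under eq_bigr do rewrite dE; rewrite rademacher_variance sumr_const card_ord.
rewrite -[leLHS]mulr_natl mulrA expr2 mulrA divff ?gt_eqF // mul1r.
by rewrite ler_piMr ?invr_ge0 ?(ltW n0') // lerBlDr lerDl sqr_ge0.
Qed.

Theorem nonneg_power_series :
  exists2 b : nat -> R, (forall j, 0 <= b j) &
    forall t, `|t| <= 1 -> (fun J => \sum_(j < J) b j * t ^+ j) @ \oo --> f t.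
Proof.
(* All coefficients lie in the compact segment from 0 to [f 1], so one ultrafilter makes them
   converge simultaneously. *)
have [U [UU Uoo]] := ultraFilterLemma (F := \oo : set_system nat).
have UP : ProperFilter U by exact: ultra_proper.
have U1 : U [set n | (1 < n)%N] by apply: Uoo; exists 2%N.
have f10 : 0 <= f 1.
  by have := @bernstein_coef_sum_le 2 0 isT; rewrite big_ord0.
have cb n j : (1 < n)%N -> 0 <= bernstein_coef n j <= f 1.
  move=> n1; rewrite bernstein_coef_ge0 //=.
  apply: le_trans (bernstein_coef_sum_le j.+1 n1); rewrite big_ord_recr /= lerDr.
  by apply: sumr_ge0 => i _; rewrite bernstein_coef_ge0.
have exb j : exists b : R, bernstein_coef n j @[n --> U] --> b.
  have UF := ultra_fmap (bernstein_coef^~ j) UU.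
  have := @segment_compact R 0 (f 1); rewrite compact_ultra => /(_ _ UF).
  case; last by move=> b [_ Ub]; exists b.
  suff : U (bernstein_coef^~ j @^-1` `[0, f 1]) by [].
  by apply: filterS U1 => n n1 /=; rewrite in_itv; exact: cb.
have [b Ub] := choice exb.
have b0 j : 0 <= b j.
  by apply: cvgr_to_ge (Ub j) _; apply: filterS U1 => n n1; case/andP: (cb n j n1).
have sum_cvg J (c : nat -> R) :
    \sum_(j < J) bernstein_coef n j * c j @[n --> U] --> \sum_(j < J) b j * c j.
  apply: cvg_sum => j _; apply: cvgM; first exact: Ub.
  exact: cvg_cst.
have sum_cvg1 J : \sum_(j < J) bernstein_coef n j @[n --> U] --> \sum_(j < J) b j.
  by apply: cvg_sum => j _.
have tail J t : `|t| <= 1 -> `|f t - \sum_(j < J) b j * t ^+ j| <=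
    (f 1 - \sum_(j < J) b j) * `|t| ^+ J.
  move=> t1; apply: (@ler_cvg_to _ U _ _
      (fun n => `|bernstein n t - \sum_(j < J) bernstein_coef n j * t ^+ j|)
      (fun n => (f 1 - \sum_(j < J) bernstein_coef n j) * `|t| ^+ J)).
  - apply: cvg_norm; apply: cvgB (sum_cvg J (GRing.exp t)).
    by apply: cvg_trans (bernstein_cvg t1); apply: cvg_app.
  - by apply: cvgM; [apply: cvgB => //|]; exact: cvg_cst.
  - by apply: filterS U1 => n n1; apply: bernstein_tail.
have sum_le J : \sum_(j < J) b j <= f 1.
  have := tail J 1; rewrite normr1 expr1n mulr1 => /(_ (lexx _)).
  by move=> /(le_trans (normr_ge0 _)); rewrite subr_ge0.
(* No mass escapes: at a fixed [t < 1] close to 1, the remainder is at most [f 1 - f t], small by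
   continuity, plus the tail at [t], which is at most [f 1 * t ^+ J]. *)
have rem : f 1 - \sum_(j < J) b j @[J --> \oo] --> 0.
  apply/cvgrPdist_le => e e0.
  have e20 : 0 < e / 2 by rewrite divr_gt0.
  have /cvgrPdist_le /(_ _ e20) [dl /= dl0 fd] := fc (x := 1).
  pose t := 1 - Num.min (dl / 2) (1 / 2).
  have m0 : 0 < Num.min (dl / 2) (1 / 2) by rewrite lt_min !divr_gt0.
  have m1 : Num.min (dl / 2) (1 / 2) <= 1 / 2 by rewrite ge_min lexx orbT.
  have m2 : Num.min (dl / 2) (1 / 2) <= dl / 2 by rewrite ge_min lexx.
  have t0 : 0 <= t by rewrite /t; lra.
  have t1 : t < 1 by rewrite /t; lra.
  have ft : `|f 1 - f t| <= e / 2.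
    by apply: fd; rewrite /ball /= /t opprB addrCA subrr addr0 gtr0_norm; lra.
  have : f 1 * t ^+ J @[J --> \oo] --> 0.
    rewrite -[X in _ --> X](mulr0 (f 1)); apply: cvgM; first exact: cvg_cst.
    by apply: cvg_expr; rewrite ger0_norm.
  move=> /cvgrPdist_le /(_ _ e20) [N0 _ HN]; exists N0 => // J /= NJ.
  have := HN _ NJ; rewrite /= !sub0r !normrN => tJ.
  rewrite ger0_norm ?subr_ge0 ?sum_le //.
  have := tail J t; rewrite ger0_norm // => /(_ (ltW t1)).
  rewrite ger0_norm ?mulr_ge0 ?exprn_ge0 // in tJ.
  have B : (f 1 - \sum_(j < J) b j) * t ^+ J <= f 1 * t ^+ J.
    by rewrite ler_wpM2r ?exprn_ge0 // lerBlDr lerDl sumr_ge0.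
  have C : \sum_(j < J) b j * t ^+ j <= \sum_(j < J) b j.
    by apply: ler_sum => j _; rewrite ler_piMr // exprn_ile1 // ltW.
  move: ft; rewrite !ler_norml; lra.
exists b => // t t1; apply/cvgrPdist_le => e e0.
have /cvgrPdist_le /(_ _ e0) [N0 _ HN] := rem; exists N0 => // J /= NJ.
have := HN _ NJ; rewrite /= sub0r normrN ger0_norm ?subr_ge0 ?sum_le //.
move=> re; apply: le_trans re; apply: (le_trans (tail J t t1)).
by rewrite ler_piMr ?subr_ge0 ?sum_le // exprn_ile1.
Qed.

End schoenberg_series.

(** * Finite families of points and the expansion of [psi] after [acos] *)

Section finite_combinations.
Context {R : realType} {X : Type} {T : finType}.
Implicit Types (a : T -> R) (x : T -> X) (k : X -> X -> R).

Definition combination a x : seq (R * X) := [seq (a s, x s) | s <- enum T].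

Lemma pairing_combination f a x : pairing f (combination a x) = \sum_s a s * f (x s).
Proof. by rewrite /pairing big_map big_enum. Qed.

Lemma gram_combination k a x :
  gram k (combination a x) (combination a x) =
  \sum_s \sum_t a s * a t * k (x s) (x t).
Proof.
rewrite /gram pairing_combination; apply: eq_bigr => s _.
by rewrite /kcomb pairing_combination mulr_sumr; apply: eq_bigr => t _; rewrite mulrA.
Qed.

Lemma strictly_positive_definite_fin k a x : strictly_positive_definite k ->
  injective x -> gram k (combination a x) (combination a x) = 0 ->
  forall s, a s = 0.
Proof.
move=> [_ kspd] xinj k0 s.
pose e (i : 'I_#|T|) := enum_val i.
have := kspd _ (a \o e) (x \o e) (inj_comp xinj enum_val_inj).
move=> /(_ _ (enum_rank s)); rewrite /= /e enum_rankK; apply.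
rewrite -k0 gram_combination big_enum_val; apply: eq_bigr => i _.
by rewrite [RHS]big_enum_val.
Qed.

End finite_combinations.

Section clip.
Context {R : realType}.

Definition clip (a b x : R) : R := Num.max a (Num.min b x).

Lemma clip_itv a b x : a <= b -> a <= clip a b x <= b.
Proof. by move=> ab; rewrite /clip le_max lexx ge_max ab ge_min lexx. Qed.

Lemma clip_id a b x : a <= x <= b -> clip a b x = x.
Proof. by move=> /andP[ax xb]; rewrite /clip (min_idPr xb) (max_idPr ax). Qed.

Lemma continuous_clip a b : continuous (clip a b).
Proof.
move=> x; apply: (@continuous_max _ _ (fun=> a) (Num.min b)).
  exact: cst_continuous.
apply: (@continuous_min _ _ (fun=> b) id); first exact: cst_continuous.
by move=> y; exact: cvg_id.
Qed.

Lemma within_continuous_clip a b (g : R -> R) : a <= b ->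
  {within `[a, b], continuous g} -> continuous (g \o clip a b).
Proof.
move=> ab /subspace_continuousP gc x.
have cab y : `[a, b]%classic (clip a b y) by rewrite /= in_itv; exact: clip_itv.
apply: cvg_comp (gc _ (cab x)) => A /= wA.
have wA' : nbhs x (clip a b @^-1` [set y | y \in `[a, b] -> A y]).
  exact: continuous_clip.
by apply: filterS wA' => y /=; apply; rewrite in_itv /=; exact: clip_itv.
Qed.

Lemma within_continuous_acos : {within `[-1, 1], continuous (@acos R)}.
Proof.
have := @segment_can_ge_continuous R 0 pi cos acos (pi_ge0 R).
rewrite cos0 cospi; apply; last exact: cosK.
by apply: continuous_subspaceT => x; exact: continuous_cos.
Qed.

End clip.

(** Clipping the arguments of [acos] and of [psi] extends the composite to the whole line, so that
    later limits need no subspace topology. *)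
Lemma continuous_comp_acos {R : realType} (psi : R -> R) :
  {within `[0, pi], continuous psi} ->
  exists2 f, continuous f & forall t, `|t| <= 1 -> f t = psi (acos t).
Proof.
move=> psic; exists ((psi \o clip 0 pi) \o (acos \o clip (-1) 1)).
  move=> t; apply: continuous_comp.
    by apply: within_continuous_clip; [lra|exact: within_continuous_acos].
  by apply: within_continuous_clip => //; exact: pi_ge0.
move=> t; rewrite ler_norml => t1; rewrite /= (clip_id t1) clip_id //.
by rewrite acos_ge0 // acos_lepi.
Qed.

Lemma schoenberg {R : realType} (psi : R -> R) : Psi_infty R psi ->
  exists2 b : nat -> R, (forall j, 0 <= b j) &
    forall t, `|t| <= 1 ->
      (fun J => \sum_(j < J) b j * t ^+ j) @ \oo --> psi (acos t).
Proof.
move=> hpsi; have psic : {within `[0, pi], continuous psi} by case: (hpsi 1%N isT).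
have [f fc fE] := continuous_comp_acos psic.
suff fpd n : (1 < n)%N -> forall a : {ffun 'I_n -> bool} -> R,
    0 <= \sum_h \sum_h' a h * a h' * f (sign_mean (sign_mul h h')).
  have [b b0 fb] := nonneg_power_series fc fpd.
  by exists b => // t t1; rewrite -fE //; apply: fb.
case: n => [|[|m]] // _ a; pose c : R := (Num.sqrt m.+2%:R)^-1.
have c2 : c * c = m.+2%:R^-1.
  by rewrite -invfM -expr2 sqr_sqrtr.
pose p (h : {ffun 'I_m.+2 -> bool}) : 'rV[R]_m.+2 := \row_i ((-1) ^+ h i * c).
have dp h h' : dotp (p h) (p h') = sign_mean (sign_mul h h').
  rewrite /dotp /sign_mean mulr_sumr; apply: eq_bigr => i _.
  by rewrite !mxE ffunE mulrACA c2 mulrC signr_addb.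
have ps h : p h \in unit_sphere R m.+1.
  rewrite inE /unit_sphere /= dp /sign_mean.
  under eq_bigr do rewrite ffunE addbb expr0.
  by rewrite sumr_const card_ord mulVf.
pose x h : sphere R m.+1 := exist (fun x => x \in unit_sphere R m.+1) _ (ps h).
have [_ kk] := hpsi m.+1 isT.
have := gram_ge0 (combination a x) kk; rewrite gram_combination.
move=> /le_trans; apply; apply: ler_sum => h _; apply: ler_sum => h' _.
by rewrite /isotropic /geodesic /= dp fE // ler_norml sign_mean_itv.
Qed.

(** * Compactness of the sphere and density of polynomials *)

Section sphere_topology.
Context {R : realType} {d : nat}.
Local Notation S := (sphere R d).
Implicit Types (x y : S).

Lemma continuous_sphere_val : continuous (val : S -> 'rV[R]_d.+1).
Proof. exact: initial_continuous. Qed.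

Definition sphere_coord (i : 'I_d.+1) (x : S) : R := val x ord0 i.

Lemma continuous_sphere_coord i : continuous (sphere_coord i).
Proof.
move=> x; apply: (continuous_comp (g := fun M : 'rV[R]_d.+1 => M ord0 i)).
  exact: continuous_sphere_val.
exact: coord_continuous.
Qed.

Lemma dotpE x y :
  dotp (val x) (val y) = \sum_i sphere_coord i x * sphere_coord i y.
Proof. by []. Qed.

Lemma dotp_sphere x : dotp (val x) (val x) = 1.
Proof. by have := valP x; rewrite inE. Qed.

Lemma sphere_coord_le1 i x : `|sphere_coord i x| <= 1.
Proof.
rewrite -(ler_pXn2r (ltn0Sn 1)) ?nnegrE ?normr_ge0 // expr1n real_normK ?num_real //.
rewrite -(dotp_sphere x) dotpE (bigD1 i) //= -expr2 lerDl.
by apply: sumr_ge0 => j _; rewrite -expr2 sqr_ge0.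
Qed.

Lemma dotp_le1 x y : `|dotp (val x) (val y)| <= 1.
Proof.
have E (s : R) : s ^+ 2 = 1 -> 0 <= 2 + 2 * s * dotp (val x) (val y).
  move=> s1; have -> : 2 + 2 * s * dotp (val x) (val y) =
      \sum_i (sphere_coord i x + s * sphere_coord i y) ^+ 2.
    transitivity (dotp (val x) (val x) + s ^+ 2 * dotp (val y) (val y) +
      2 * s * dotp (val x) (val y)); first by rewrite !dotp_sphere s1; ring.
    rewrite !dotpE !mulr_sumr -!big_split; apply: eq_bigr => i _ /=; ring.
  by apply: sumr_ge0 => i _; rewrite sqr_ge0.
have := E 1; rewrite expr1n => /(_ erefl) A.
have := E (-1); rewrite sqrrN expr1n => /(_ erefl) B.
by rewrite ler_norml; apply/andP; split; lra.
Qed.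

Lemma sphere_ball x y e : 0 < e ->
  (forall i, `|sphere_coord i x - sphere_coord i y| < e) -> ball x e y.
Proof.
move=> e0 xy; suff : ball (val x) e (val y) by [].
by split=> // i j; rewrite (ord1 i); exact: xy.
Qed.

Lemma sphere_compact : compact [set: S].
Proof.
have uc : compact (unit_sphere R d).
  apply: (@subclosed_compact _ _ [set v : 'rV[R]_d.+1 |
      forall i, `[-1, 1]%classic (v ord0 i)]).
  - have : closed ((fun v : 'rV[R]_d.+1 => dotp v v) @^-1` [set 1]).
      apply: preimage_closed; last exact: closed_eq.
      move=> v _; apply: (@cvg_sum R _ _ (nbhs v) _ _ _
        (fun i (w : 'rV[R]_d.+1) => w ord0 i * w ord0 i)) => i _.
      by apply: cvgM; exact: coord_continuous.
    by [].
  - by apply: (@rV_compact R d.+1 (fun=> `[-1, 1]%classic)) => i; exact: segment_compact.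
  - move=> v v1 i /=; have vS : v \in unit_sphere R d by rewrite inE.
    have := sphere_coord_le1 i (exist _ v vS : S).
    by rewrite /sphere_coord /= ler_norml in_itv.
(* Compactness passes from the set of unit vectors to the subtype by pushing ultrafilters forward
   along [val]. *)
rewrite compact_ultra => F UF FT.
have UvF := ultra_fmap (val : S -> 'rV[R]_d.+1) UF.
move: uc; rewrite compact_ultra => /(_ _ UvF)[].
  suff : F ((val : S -> 'rV[R]_d.+1) @^-1` unit_sphere R d) by [].
  by apply: filterS FT => x _ /=; have := valP x; rewrite inE.
move=> p [p1 Fp]; have pS : p \in unit_sphere R d by rewrite inE.
exists (exist _ p pS : S); split=> //.
move=> A /nbhs_ballP[e e0 eA].
have : F ((val : S -> 'rV[R]_d.+1) @^-1` ball p e).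
  by apply: Fp; exact: nbhsx_ballx.
by apply: filterS => x px; apply: eA.
Qed.

Lemma sphere_bounded (f : S -> R) : continuous f ->
  exists M, forall x, `|f x| <= M.
Proof.
move=> fc; have [||c _ cM] := @compact_EVT_max _ R (fun x => `|f x|) _ _ sphere_compact.
- by exists point.
- by apply: continuous_subspaceT => x; apply: continuous_comp; [exact: fc|exact: norm_continuous].
- by exists `|f c| => x; apply: cM; rewrite inE.
Qed.

Lemma sphere_unif_continuous (f : S -> R) e : continuous f -> 0 < e ->
  exists2 dl, 0 < dl & forall x y, ball x dl y -> `|f x - f y| <= e.
Proof.
move=> fc e0; have e20 : 0 < e / 2 by rewrite divr_gt0.
have /compact_near_coveringP K := sphere_compact.
have := K _ (0^'+ : set_system R)
  (fun dl x => forall y, ball x dl y -> `|f x - f y| <= e) _.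
case.
  move=> x _; have /cvgrPdist_le /(_ _ e20) := fc x.
  move=> /nbhs_ballP[r /= r0 xr].
  exists (ball x (r / 2), [set dl | dl < r / 2]).
    split; first by apply: nbhsx_ballx; rewrite divr_gt0.
    by apply: nbhs_right_lt; rewrite divr_gt0.
  move=> [x' dl] /= [xx' dlr] y x'y; rewrite (splitr e).
  have ry : ball x r y.
    by rewrite (splitr r); apply: ball_triangle xx' _; apply: le_ball x'y; exact: ltW.
  have rx' : ball x r x' by apply: le_ball xx'; rewrite ler_pdivrMr // ler_pMr // ler1n.
  have -> : f x' - f y = (f x - f y) - (f x - f x') by ring.
  by apply: (le_trans (ler_normB _ _)); rewrite lerD //; apply: xr.
move=> r r0 rP; exists (r / 2) => [|x y]; first by rewrite /= divr_gt0.
apply: (rP (r / 2)) => //=; last by rewrite divr_gt0.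
by rewrite sub0r normrN gtr0_norm ?divr_gt0 // ltr_pdivrMr // ltr_pMr // ltr1n.
Qed.

Inductive polynomial_function : (S -> R) -> Prop :=
| polyfun_cst c : polynomial_function (fun=> c)
| polyfun_coord i : polynomial_function (sphere_coord i)
| polyfun_add f g : polynomial_function f -> polynomial_function g ->
    polynomial_function (fun x => f x + g x)
| polyfun_mul f g : polynomial_function f -> polynomial_function g ->
    polynomial_function (fun x => f x * g x).

Lemma polyfun_sum (I : Type) (r : seq I) (F : I -> S -> R) :
  (forall i, polynomial_function (F i)) ->
  polynomial_function (fun x => \sum_(i <- r) F i x).
Proof.
move=> Fp; elim: r => [|i r IH].
  by rewrite (_ : (fun _ => _) = fun=> 0);
    [exact: polyfun_cst|apply/funext => x; rewrite big_nil].
rewrite (_ : (fun _ => _) = fun x => F i x + \sum_(j <- r) F j x).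
  exact: polyfun_add.
by apply/funext => x; rewrite big_cons.
Qed.

Lemma polyfun_prod (I : Type) (r : seq I) (F : I -> S -> R) :
  (forall i, polynomial_function (F i)) ->
  polynomial_function (fun x => \prod_(i <- r) F i x).
Proof.
move=> Fp; elim: r => [|i r IH].
  by rewrite (_ : (fun _ => _) = fun=> 1);
    [exact: polyfun_cst|apply/funext => x; rewrite big_nil].
rewrite (_ : (fun _ => _) = fun x => F i x * \prod_(j <- r) F j x).
  exact: polyfun_mul.
by apply/funext => x; rewrite big_cons.
Qed.

(** Each coordinate has its own block of [n] signs; their means form a random grid point of the
    cube, centred at [x] under the weights used below. *)
Definition coord_mean n (h : {ffun 'I_d.+1 * 'I_n -> bool}) (i : 'I_d.+1) : R :=
  n%:R^-1 * \sum_j (-1) ^+ h (i, j).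

Lemma coord_mean_variance n x i : (0 < n)%N ->
  \sum_h rademacher_weight (fun p : 'I_d.+1 * 'I_n => sphere_coord p.1 x) h *
    (coord_mean h i - sphere_coord i x) ^+ 2 <= n%:R^-1.
Proof.
move=> n0; have n0' : n%:R != 0 :> R by rewrite pnatr_eq0 -lt0n.
(* The coefficients [n%:R^-1 *+ (p.1 == i)] select block [i], which brings the sum into the form of
   [rademacher_variance]. *)
have E (G : 'I_d.+1 * 'I_n -> R) : \sum_p (n%:R^-1 *+ (p.1 == i)) * G p =
    n%:R^-1 * \sum_j G (i, j).
  transitivity (\sum_i' \sum_j (n%:R^-1 *+ (i' == i)) * G (i', j)).
    by rewrite pair_bigA; apply: eq_bigr => -[i' j].
  rewrite (bigD1 i) //= [X in _ + X]big1 => [|i' /negPf ii'].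
    by rewrite addr0 eqxx mulr_sumr.
  by rewrite big1 // => j _; rewrite ii' mul0r.
under eq_bigr => h _.
  rewrite (_ : _ - _ = \sum_p (n%:R^-1 *+ (p.1 == i)) *
      ((-1) ^+ h p - sphere_coord p.1 x)); last first.
    rewrite E /= sumrB sumr_const card_ord mulrBr /coord_mean.
    by rewrite -[sphere_coord i x *+ n]mulr_natl mulKf.
  over.
rewrite rademacher_variance.
under eq_bigr do rewrite expr2 -mulrA; rewrite E /= eqxx.
rewrite sumr_const card_ord -mulrnAl -[n%:R^-1 *+ n]mulr_natl mulfV // mul1r.
by rewrite ler_piMr ?invr_ge0 // lerBlDr lerDl sqr_ge0.
Qed.

(* The Bernstein operator on the cube, applied to a function that is only known
   on the sphere: grid points near the sphere take the value at a nearby point,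
   the other grid points have negligible weight. *)
Theorem sphere_weierstrass (f : S -> R) e : continuous f -> 0 < e ->
  exists2 g, polynomial_function g & forall x, `|f x - g x| < e.
Proof.
move=> fc e0; have [M fM] := sphere_bounded fc.
have e30 : 0 < e / 3 by rewrite divr_gt0.
have [dl dl0 fdl] := sphere_unif_continuous fc e30.
pose r := dl / 2; have r0 : 0 < r by rewrite divr_gt0.
have M0 : 0 <= M by apply: le_trans (fM point).
pose K := 2 * M / r ^+ 2.
have K0 : 0 <= K by rewrite divr_ge0 ?sqr_ge0 ?mulr_ge0.
have [n0 _ Hn] := nbhs_infty_ger (K * d.+1%:R / (e / 3)).
pose n := maxn 1 n0.
have n1 : (0 < n)%N by rewrite leq_max.
have n1' : 0 < n%:R :> R by rewrite ltr0n.
have Kn : K * (d.+1%:R / n%:R) <= e / 3.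
  rewrite mulrA ler_pdivrMr // [leRHS]mulrC -ler_pdivrMr //; apply: Hn.
  by rewrite /= leq_maxr.
pose near (h : {ffun 'I_d.+1 * 'I_n -> bool}) := [set y : S | forall i, `|coord_mean h i - sphere_coord i y| < r].
pose F (h : {ffun 'I_d.+1 * 'I_n -> bool}) := f (xget point (near h)).
exists (fun x => \sum_h F h *
    rademacher_weight (fun p : 'I_d.+1 * 'I_n => sphere_coord p.1 x) h).
  apply: polyfun_sum => h; apply: polyfun_mul; first exact: polyfun_cst.
  apply: polyfun_prod => p; apply: polyfun_mul; last exact: polyfun_cst.
  apply: polyfun_add; first exact: polyfun_cst.
  by apply: polyfun_mul; [exact: polyfun_coord|exact: polyfun_cst].
move=> x; rewrite distrC; under eq_bigr do rewrite mulrC.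
apply: (@le_lt_trans _ _ (e / 3 + K * (d.+1%:R / n%:R))); last by lra.
apply: (rademacher_mean_close
  (dev := fun h => \sum_i (coord_mean h i - sphere_coord i x) ^+ 2)) => //.
- by move=> p; exact: sphere_coord_le1.
- move=> h; have [xh|] := pselect (near h x).
    have := xgetPex point (ex_intro _ x xh); rewrite -/(near h).
    set y := xget _ _ => yh.
    apply: (@le_trans _ _ (e / 3)); last first.
      by rewrite lerDl mulr_ge0 // sumr_ge0 // => i _; rewrite sqr_ge0.
    apply: fdl; apply: sphere_ball => // i.
    rewrite (splitr dl) -(subrKA (coord_mean h i)).
    apply: (le_lt_trans (ler_normD _ _)).
    apply: ltrD; last exact: (xh i).
    by rewrite distrC; exact: (yh i).
  move=> /existsNP[i] /negP; rewrite -leNgt => far.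
  apply: (@le_trans _ _ (2 * M)).
    apply: (le_trans (ler_normB _ _)); rewrite mulr_natl mulr2n lerD //; exact: fM.
  rewrite ler_wpDl ?(ltW e30) // /K mulrAC ler_pdivlMr ?exprn_gt0 //.
  rewrite ler_wpM2l ?mulr_ge0 // (bigD1 i) //= ler_wpDr ?sumr_ge0 // => [j _|].
    exact: sqr_ge0.
  by rewrite -[leRHS]real_normK ?num_real // ler_pXn2r ?nnegrE // ltW.
- under eq_bigr do rewrite mulr_sumr; rewrite exchange_big /=.
  rewrite mulr_natl -[X in _ *+ X](card_ord d.+1) -sumr_const.
  by apply: ler_sum => i _; exact: coord_mean_variance.
Qed.

End sphere_topology.

(** * Polynomials in the RKHS and universality *)

Lemma continuous_slice {R : realType} {X : topologicalType} (k : X -> X -> R) x :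
  continuous (fun p : X * X => k p.1 p.2) ->
  k x y @[y --> x] --> k x x /\ k y y @[y --> x] --> k x x.
Proof.
move=> kc; split.
  apply: (@continuous_comp _ _ _ (fun y => (x, y)) (fun p => k p.1 p.2)).
    by apply: cvg_pair; [exact: cvg_cst|exact: cvg_id].
  exact: kc.
apply: (@continuous_comp _ _ _ (fun y => (y, y)) (fun p => k p.1 p.2)).
  by apply: cvg_pair; exact: cvg_id.
exact: kc.
Qed.

(** Cauchy-Schwarz for the difference of the Dirac masses at [x] and [y] bounds [(f x - f y)^2] by
    the norm squared times [k x x - 2 * k x y + k y y]. *)
Lemma rkhs_continuous {R : realType} {X : topologicalType} (k : X -> X -> R) f :
  is_kernel k -> continuous (fun p : X * X => k p.1 p.2) ->
  rkhs k f -> continuous f.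
Proof.
move=> kk kc Hf x; have [c1 c2] := continuous_slice x kc.
apply/cvgrPdist_le => e e0.
have : rkhs_sqnorm k f * (k x x - 2 * k x y + k y y) @[y --> x] --> 0.
  rewrite -[X in _ --> X](_ : rkhs_sqnorm k f * (k x x - 2 * k x x + k x x) = 0).
    apply: cvgM; first exact: cvg_cst.
    apply: cvgD => //; apply: cvgB; first exact: cvg_cst.
    by apply: cvgM => //; exact: cvg_cst.
  by ring.
move=> /cvgrPdist_le /(_ _ (exprn_gt0 2 e0)).
apply: filterS => y; rewrite sub0r normrN => /(le_trans (ler_norm _)) ye.
rewrite -(ler_pXn2r (ltn0Sn 1)) ?nnegrE ?normr_ge0 ?(ltW e0) //.
rewrite real_normK ?num_real //; apply: le_trans ye.
have := pairing_sqr_le kk [:: (1, x); (-1, y)] Hf.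
have [ks _] := kk.
rewrite /gram /kcomb !pairing_cons !pairing_nil /=.
rewrite (ks y x); congr (_ <= _); ring.
Qed.

Lemma continuous_comp_sum_mul {R : realType} {X : topologicalType} {I : finType}
    (g : I -> X -> R) (f : R -> R) : (forall i, continuous (g i)) -> continuous f ->
  continuous (fun p : X * X => f (\sum_i g i p.1 * g i p.2)).
Proof.
move=> gc fc p.
apply: (continuous_comp (f := fun p : X * X => \sum_i g i p.1 * g i p.2));
  last exact: fc.
apply: (@cvg_sum R _ _ (nbhs p) _ _ _ (fun i (p : X * X) => g i p.1 * g i p.2)) => i _.
apply: cvgM.
  by apply: (continuous_comp (f := fst)); [exact: cvg_fst|exact: gc].
by apply: (continuous_comp (f := snd)); [exact: cvg_snd|exact: gc].
Qed.

Section monomials.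
Context {R : realType} {d : nat}.
Local Notation S := (sphere R d).

Definition monomial (w : seq 'I_d.+1) (x : S) : R := \prod_(i <- w) sphere_coord i x.

Definition dot_power m (x y : S) : R := dotp (val x) (val y) ^+ m.

(** Expanding the power of the inner product over words of length [m] exhibits the tensor power as
    feature map; several words may give the same monomial. *)
Lemma gram_dot_power m u : gram (dot_power m) u u =
  \sum_(w : {ffun 'I_m -> 'I_d.+1}) pairing (monomial (codom w)) u ^+ 2.
Proof.
have E x y : dot_power m x y = \sum_(w : {ffun 'I_m -> 'I_d.+1})
    monomial (codom w) x * monomial (codom w) y.
  rewrite /dot_power dotpE -[X in _ ^+ X]card_ord -prodr_const bigA_distr_bigA.
  apply: eq_bigr => w _; rewrite big_split /=.
  by rewrite /monomial !big_image.
rewrite /gram (eq_pairing (g := fun x => \sum_(w : {ffun 'I_m -> 'I_d.+1})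
    pairing (monomial (codom w)) u * monomial (codom w) x)) => [|x].
  by rewrite pairing_sum.
rewrite /kcomb (eq_pairing _ (E x)) pairing_sum.
by apply: eq_bigr => w _; rewrite mulrC.
Qed.

Lemma pairing_monomial_le s u :
  pairing (monomial s) u ^+ 2 <= gram (dot_power (size s)) u u.
Proof.
have E : pairing (monomial s) u ^+ 2 =
    pairing (monomial (codom [ffun i => tnth (in_tuple s) i])) u ^+ 2.
  congr (pairing (monomial _) _ ^+ 2).
  rewrite -[LHS](map_tnth_enum (in_tuple s)) /codom /image_mem.
  by apply: eq_map => i; rewrite ffunE.
rewrite gram_dot_power E (bigD1 [ffun i => tnth (in_tuple s) i]) //= lerDl.
by apply: sumr_ge0 => w _; rewrite sqr_ge0.
Qed.

Lemma gram_dot_power_ge0 m u : 0 <= gram (dot_power m) u u.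
Proof. by rewrite gram_dot_power sumr_ge0 // => w _; rewrite sqr_ge0. Qed.

Lemma monomial_cons2 i s x :
  monomial [:: i, i & s] x = sphere_coord i x ^+ 2 * monomial s x.
Proof. by rewrite /monomial !big_cons mulrA. Qed.

Lemma monomial_sphere s x : monomial s x = \sum_i monomial [:: i, i & s] x.
Proof.
under eq_bigr do rewrite monomial_cons2; rewrite -mulr_suml.
by under eq_bigr do rewrite expr2; rewrite -dotpE dotp_sphere mul1r.
Qed.

Definition linear_closed (V : set (S -> R)) :=
  V (fun=> 0) /\ forall a f g, V f -> V g -> V (a \*o f \+ g).

Lemma linear_closed_sum V (I : Type) (r : seq I) (F : I -> S -> R) :
  linear_closed V -> (forall i, V (F i)) -> V (fun x => \sum_(i <- r) F i x).
Proof.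
move=> [V0 Vlin] VF; elim: r => [|i r IH].
  by under eq_fun do rewrite big_nil.
rewrite (_ : (fun _ => _) = 1 \*o F i \+ (fun x => \sum_(j <- r) F j x)).
  exact: Vlin.
by apply/funext => x; rewrite big_cons /= mul1r.
Qed.

(* Multiplying by [\sum_i x_i ^ 2 = 1] raises the degree of a monomial by two. *)
Lemma linear_closed_monomial_size V s j : linear_closed V ->
  (forall t, size t = (size s + j.*2)%N -> V (monomial t)) -> V (monomial s).
Proof.
move=> Vl; elim: j s => [|j IH] s Vs; first by apply: Vs; rewrite addn0.
rewrite (_ : monomial s = fun x => \sum_i monomial [:: i, i & s] x).
  apply: linear_closed_sum => // i; apply: IH => t ts; apply: Vs.
  by rewrite ts /= doubleS !addnS.
by apply/funext => x; rewrite -monomial_sphere.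
Qed.

Lemma linear_closed_mul V (g : S -> R) : linear_closed V ->
  linear_closed [set f | V (fun x => g x * f x)].
Proof.
move=> [V0 Vlin]; split=> [|a f h Vf Vh] /=.
  by under eq_fun do rewrite mulr0.
rewrite (_ : (fun _ => _) = a \*o (fun x => g x * f x) \+ (fun x => g x * h x)).
  exact: Vlin.
by apply/funext => x /=; rewrite mulrDr mulrCA.
Qed.

(** For products the induction must hold for all [V]: the functions [h] with [V (f h)] form another
    linear space, and two such changes of space reduce to products of monomials. *)
Lemma linear_closed_polyfun V g : linear_closed V ->
  (forall s, V (monomial s)) -> polynomial_function g -> V g.
Proof.
move=> Vl Vm pg; elim: pg V Vl Vm => {g} [c|i|f g _ IHf _ IHg|f g _ IHf _ IHg] V Vl Vm.
- rewrite (_ : (fun _ => _) = c \*o monomial [::] \+ (fun=> 0)).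
    by apply: Vl.2 => //; exact: Vl.1.
  by apply/funext => x; rewrite /= /monomial big_nil mulr1 addr0.
- rewrite (_ : sphere_coord i = monomial [:: i]) //.
  by apply/funext => x; rewrite /monomial big_seq1.
- rewrite (_ : (fun _ => _) = 1 \*o f \+ g).
    by apply: Vl.2; [exact: IHf|exact: IHg].
  by apply/funext => x; rewrite /= mul1r.
- apply: (IHg [set h | V (fun x => f x * h x)]) => [|t]; first exact: linear_closed_mul.
  rewrite /= (_ : (fun _ => _) = fun x => monomial t x * f x); last first.
    by apply/funext => x; rewrite mulrC.
  apply: (IHf [set h | V (fun x => monomial t x * h x)]) => [|s].
    exact: linear_closed_mul.
  rewrite /= (_ : (fun _ => _) = monomial (t ++ s)) //.
  by apply/funext => x; rewrite /monomial big_cat.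
Qed.

End monomials.

Definition infinitely_many_parity {R : realType} (b : nat -> R) :=
  forall (p : bool) (N : nat), exists m, [/\ (N <= m)%N, odd m = p & 0 < b m].

Section isotropic_kernels.
Context {R : realType} {d : nat}.
Variables (psi : R -> R) (b : nat -> R).
Local Notation S := (sphere R d).
Local Notation k := (isotropic d psi).
Hypothesis psic : {within `[0, pi], continuous psi}.
Hypothesis kk : is_kernel k.
Hypothesis b0 : forall j, 0 <= b j.
Hypothesis psiE : forall t, `|t| <= 1 ->
  (fun J => \sum_(j < J) b j * t ^+ j) @ \oo --> psi (acos t).

Lemma continuous_isotropic : continuous (fun p : S * S => k p.1 p.2).
Proof.
have [f fc fE] := continuous_comp_acos psic.
rewrite (_ : (fun _ => _) = fun p : S * S =>
    f (\sum_i sphere_coord i p.1 * sphere_coord i p.2)).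
  by apply: (continuous_comp_sum_mul _ fc) => i; exact: continuous_sphere_coord.
by apply/funext => p /=; rewrite -dotpE fE // dotp_le1.
Qed.

Lemma gram_isotropic_cvg u :
  (fun J => \sum_(j < J) b j * gram (dot_power j) u u) @ \oo --> gram k u u.
Proof.
rewrite (_ : (fun _ => _) = fun J => \sum_(q <- u) \sum_(p <- u)
    q.1 * (p.1 * \sum_(j < J) b j * dot_power j q.2 p.2)); last first.
  apply/funext => J; under eq_bigr do rewrite gramE mulr_sumr.
  rewrite exchange_big; apply: eq_bigr => q _.
  under eq_bigr do rewrite mulr_sumr.
  rewrite exchange_big; apply: eq_bigr => p _.
  by rewrite !mulr_sumr; apply: eq_bigr => j _; ring.
rewrite gramE; apply: cvg_sum => q _; apply: cvg_sum => p _.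
apply: cvgM; first exact: cvg_cst.
by apply: cvgM; [exact: cvg_cst|exact: psiE (dotp_le1 _ _)].
Qed.

Lemma gram_isotropic_ge m u : b m * gram (dot_power m) u u <= gram k u u.
Proof.
apply: cvgr_to_ge (@gram_isotropic_cvg u) _; exists m.+1 => // J /= mJ.
rewrite (bigD1 (Ordinal mJ)) //= lerDl.
by apply: sumr_ge0 => j _; rewrite mulr_ge0 // gram_dot_power_ge0.
Qed.

Lemma rkhs_linear_closed : linear_closed (rkhs k : set (S -> R)).
Proof. by split; [exact: rkhs0|move=> a f g; exact: rkhs_lin]. Qed.

(** With [m] the degree, the squared pairing is at most the Gram value of [<x,y>^m], and [b m] times
    that is at most the Gram value of [k]; hence the constant [(b m)^-1]. *)
Lemma monomial_rkhs s : 0 < b (size s) -> rkhs k (monomial s).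
Proof.
move=> bs; apply: (@rkhs_criterion _ _ _ kk _ (b (size s))^-1).
  by rewrite invr_ge0 ltW.
move=> u; rewrite mulrC ler_pdivlMr // mulrC.
apply: le_trans (gram_isotropic_ge (size s) u).
by rewrite ler_wpM2l // pairing_monomial_le.
Qed.

Lemma polyfun_rkhs g : infinitely_many_parity b ->
  polynomial_function g -> rkhs k g.
Proof.
move=> bi; apply: linear_closed_polyfun; first exact: rkhs_linear_closed.
move=> s; have [m [sm om bm]] := bi (odd (size s)) (size s).
apply: (@linear_closed_monomial_size _ _ _ _ (m - size s)./2).
  exact: rkhs_linear_closed.
move=> t; rewrite even_halfK ?subnKC // => [tm|]; last by rewrite oddB // om addbb.
by apply: monomial_rkhs; rewrite tm.
Qed.

Lemma isotropic_universal : infinitely_many_parity b -> universal k.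
Proof.
move=> bi; split; first exact: continuous_isotropic.
exists (rkhs k), (rkhs_ip k); split.
- exact: moore_aronszajn.
- by move=> f; apply: rkhs_continuous => //; exact: continuous_isotropic.
- move=> f fc e e0; have [g gp fg] := sphere_weierstrass fc e0.
  by exists g => //; exact: polyfun_rkhs.
Qed.

End isotropic_kernels.

(** In any RKHS of [k] the function [kcomb k u] represents pairing with [u]. Its squared norm is the
    Gram value 0, so it vanishes. *)
Lemma rkhs_null_combination {R : realType} {X : Type} (k : X -> X -> R) H ip u f :
  is_rkhs k H ip -> gram k u u = 0 -> H f -> pairing f u = 0.
Proof.
move=> [[z lin ipl ips _ ipe _] kH rep] u0 Hf.
have k0 : kcomb k [::] = fun=> 0.
  by apply/funext => x; rewrite /kcomb pairing_nil.
have Hk v : H (kcomb k v) /\ forall g, H g -> ip (kcomb k v) g = pairing g v.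
  elim: v => [|p v [IH1 IH2]].
    rewrite k0; split=> // g Hg; have := ipl (-1) _ _ _ z z Hg.
    rewrite (_ : _ \+ _ = fun=> 0) => [->|]; first by rewrite pairing_nil; ring.
    by apply/funext => x /=; rewrite mulr0 addr0.
  rewrite (_ : kcomb k (p :: v) = p.1 \*o k^~ p.2 \+ kcomb k v); last first.
    by apply/funext => x; rewrite /kcomb pairing_cons.
  split=> [|g Hg]; first exact: lin.
  by rewrite ipl // IH2 // pairing_cons (rep g) // ips.
have [Hku ipu] := Hk u.
have ku0 := ipe _ Hku (etrans (ipu _ Hku) u0).
by rewrite -(ipu _ Hf) ku0 -k0 (Hk [::]).2 // pairing_nil.
Qed.

Lemma pairing_dist_le {R : realType} {X : Type} (u : seq (R * X)) (f g : X -> R) e :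
  (forall x, `|f x - g x| <= e) ->
  `|pairing f u - pairing g u| <= (\sum_(p <- u) `|p.1|) * e.
Proof.
move=> fg; rewrite /pairing -sumrB mulr_suml.
apply: (le_trans (ler_norm_sum _ _ _)); apply: ler_sum => p _.
by rewrite -mulrBr normrM ler_wpM2l.
Qed.

Lemma universal_null_combination {R : realType} {X : topologicalType}
    (k : X -> X -> R) u f :
  universal k -> gram k u u = 0 -> continuous f -> pairing f u = 0.
Proof.
move=> [_ [H [ip [Hk _ Hd]]]] u0 fc.
apply/eqP; rewrite -normr_le0; apply/ler_addgt0Pr => e e0; rewrite add0r.
pose c := 1 + \sum_(p <- u) `|p.1|.
have c0 : 0 < c by rewrite ltr_wpDr // sumr_ge0.
have ec0 : 0 < e / c by rewrite divr_gt0.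
have [g Hg fg] := Hd f fc _ ec0.
rewrite -[pairing f u]subr0 -(rkhs_null_combination Hk u0 Hg).
apply: (le_trans (pairing_dist_le u (fun x => ltW (fg x)))).
rewrite mulrA ler_pdivrMr // mulrC ler_wpM2l ?(ltW e0) //.
by rewrite /c lerDr.
Qed.

(** * From universality to strict positive definiteness *)

Section universal_strictly_positive_definite.
Context {R : realType} {d : nat}.
Local Notation S := (sphere R d).

Lemma dist_sphere_eq0 (x y : S) :
  (\sum_i (sphere_coord i x - sphere_coord i y) ^+ 2 == 0) = (x == y).
Proof.
apply/idP/eqP => [|->]; last by rewrite big1 // => i _; rewrite subrr expr0n.
rewrite psumr_eq0 => [/allP xy|i _]; last exact: sqr_ge0.
apply/val_inj/rowP => i; have := xy i (mem_index_enum i).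
by rewrite sqrf_eq0 subr_eq0 => /eqP.
Qed.

Lemma continuous_polyfun (f : S -> R) : polynomial_function f -> continuous f.
Proof.
elim=> [c|i|{}f g _ fc _ gc|{}f g _ fc _ gc] x.
- exact: cst_continuous.
- exact: continuous_sphere_coord.
- exact: (continuousD (fc x) (gc x)).
- exact: (continuousM (fc x) (gc x)).
Qed.

Lemma universal_strictly_positive_definite (k : S -> S -> R) :
  is_kernel k -> universal k -> strictly_positive_definite k.
Proof.
move=> kk ku; split=> // n a x xinj k0 i.
have u0 : gram k (combination a x) (combination a x) = 0.
  by rewrite gram_combination.
(* The product of the squared distances to the other points vanishes at each of them but not at
   [x i], so pairing with it isolates [a i]. *)
pose f (y : S) := \prod_j (if j == i then 1 else
  \sum_l (sphere_coord l y + (-1) * sphere_coord l (x j)) *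
         (sphere_coord l y + (-1) * sphere_coord l (x j))).
have fc : continuous f.
  apply: continuous_polyfun; apply: polyfun_prod => j; case: (j == i).
    exact: polyfun_cst 1.
  apply: polyfun_sum => l.
  by apply: polyfun_mul; apply: polyfun_add; (exact: polyfun_coord || exact: polyfun_cst).
have fE y : f y = \prod_(j | j != i)
    \sum_l (sphere_coord l y - sphere_coord l (x j)) ^+ 2.
  rewrite [RHS]big_mkcond; apply: eq_bigr => j _; case: eqP => //= _.
  by apply: eq_bigr => l _; rewrite mulN1r expr2.
have := universal_null_combination ku u0 fc; rewrite pairing_combination.
rewrite (bigD1 i) //= big1 => [/eqP|j ji].
  rewrite addr0 mulf_eq0 => /orP[/eqP //|]; rewrite fE prodf_seq_eq0 => /hasP[j _].
  by rewrite dist_sphere_eq0 (inj_eq xinj) eq_sym => /andP[/negPf ->].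
have /eqP d0 : \sum_l (sphere_coord l (x j) - sphere_coord l (x j)) ^+ 2 == 0.
  by rewrite dist_sphere_eq0.
by rewrite fE (bigD1 j) //= d0 mul0r mulr0.
Qed.

End universal_strictly_positive_definite.

(** * Antipodal points on a circle and annihilating weights *)

Section null_combination.
Context {R : realType} {m : nat}.
Local Notation S := (sphere R m.+1).

Lemma circle_point_subproof (s : R) : `|s| <= 1 ->
  (\row_(i < m.+2) (if i == 0 then s else if i == 1 then Num.sqrt (1 - s ^+ 2) else 0))
    \in unit_sphere R m.+1.
Proof.
move=> s1; rewrite inE /unit_sphere /= /dotp !big_ord_recl big1 => [|i _].
  rewrite !mxE /= addr0 -!expr2 sqr_sqrtr; first by ring.
  by rewrite subr_ge0 -[_ ^+ 2]real_normK ?num_real // exprn_ile1.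
by rewrite !mxE /= mulr0.
Qed.

Definition circle_point (s : R) (s1 : `|s| <= 1) : S :=
  exist (fun y => y \in unit_sphere R m.+1) _ (circle_point_subproof s1).

Lemma sphere_opp_subproof (x : S) : - val x \in unit_sphere R m.+1.
Proof.
rewrite inE /unit_sphere /=; apply: etrans (dotp_sphere x).
apply: eq_bigr => i _.
by rewrite !mxE mulrNN.
Qed.

Definition sphere_opp (x : S) : S :=
  exist (fun y => y \in unit_sphere R m.+1) _ (sphere_opp_subproof x).

(** The denominator [n.+1] keeps the abscissas below 1, hence the ordinates positive, so that no
    point is the antipode of another. *)
Definition half_circle_point n (i : 'I_n) : R := i%:R / n.+1%:R.

Lemma half_circle_point_lt1 n (i : 'I_n) : `|half_circle_point i| < 1.
Proof.
rewrite ger0_norm ?divr_ge0 // /half_circle_point ltr_pdivrMr ?ltr0n // mul1r ltr_nat.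
by rewrite ltnS ltnW.
Qed.

Definition antipodal_point n (p : 'I_n * bool) : S :=
  let x := circle_point (ltW (half_circle_point_lt1 p.1)) in
  if p.2 then sphere_opp x else x.

Lemma sphere_coord_antipodal n (p : 'I_n * bool) i :
  sphere_coord i (antipodal_point p) =
  (-1) ^+ p.2 * sphere_coord i (antipodal_point (p.1, false)).
Proof.
case: p => j [] /=; rewrite ?expr1 ?expr0 ?mul1r // mulN1r.
by rewrite /sphere_coord /= !mxE.
Qed.

Lemma antipodal_point_inj n : injective (@antipodal_point n).
Proof.
move=> p q pq.
have E i := congr1 (sphere_coord i) pq.
(* The sign of coordinate 1 tells a point from an antipode; coordinate 0 then gives the index. *)
have pos (j : 'I_n) : 0 < sphere_coord 1 (antipodal_point (j, false)).
  rewrite /sphere_coord /= mxE /= sqrtr_gt0 subr_gt0.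
  by rewrite -[_ ^+ 2]real_normK ?num_real // exprn_ilt1 ?normr_ge0 ?half_circle_point_lt1.
have p2 : p.2 = q.2.
  have := E 1; rewrite sphere_coord_antipodal [RHS]sphere_coord_antipodal.
  have := pos p.1; have := pos q.1; case: p.2; case: q.2 => //=;
    rewrite expr0 expr1 mul1r mulN1r; lra.
have sn : (-1) ^+ q.2 != 0 :> R by rewrite signr_eq0.
have nn : n.+1%:R^-1 != 0 :> R by rewrite invr_eq0 pnatr_eq0.
have := E 0; rewrite sphere_coord_antipodal [RHS]sphere_coord_antipodal p2.
move=> /(mulfI sn); rewrite /sphere_coord /= !mxE /= => /(mulIf nn)/eqP.
rewrite eqr_nat => /eqP/val_inj p1.
by case: p q p1 p2 {pq E sn} => [? ?] [? ?] /= -> ->.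
Qed.

Lemma monomial_antipodal n (p : 'I_n * bool) w :
  monomial w (antipodal_point p) =
  (-1) ^+ (p.2 && odd (size w)) * monomial w (antipodal_point (p.1, false)).
Proof.
elim: w => [|i w IH]; first by rewrite /monomial !big_nil andbF mul1r.
rewrite /monomial !big_cons -/(monomial _ _) IH sphere_coord_antipodal -/(monomial _ _).
rewrite mulrACA -signr_addb /=; congr ((-1) ^+ nat_of_bool _ * _).
by case: p.2; case: (odd _).
Qed.

(** There is one more point than words of length at most [N], so the homogeneous system for the
    weights has a nonzero solution. *)
Lemma annihilating_weights N : exists n (v : 'I_n -> R), (exists i, v i != 0) /\
  forall w : seq 'I_m.+2, (size w <= N)%N ->
    \sum_i v i * monomial w (antipodal_point (i, false)) = 0.
Proof.
pose B := {bseq N of 'I_m.+2}.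
pose A : 'M[R]_(#|B|.+1, #|B|) :=
  \matrix_(i, j) monomial (enum_val j : B) (antipodal_point (i, false)).
have : kermx A != 0.
  rewrite kermx_eq0 -row_leq_rank -ltnNge ltnS; exact: rank_leq_col.
move=> /rowV0Pn[v /sub_kermxP vA v0].
exists #|B|.+1, (v ord0); split=> [|w wN].
  apply/existsP; apply: contraNT v0; rewrite negb_exists => /forallP v0.
  by apply/eqP/rowP => i; rewrite mxE; apply/eqP; rewrite -[_ == _]negbK v0.
have := congr1 (fun M : 'rV_#|B| => M ord0 (enum_rank (Bseq wN : B))) vA.
rewrite !mxE => vA0; apply: etrans vA0; apply: eq_bigr => i _.
by rewrite mxE enum_rankK.
Qed.

End null_combination.

Section strictly_positive_definite_coefficients.
Context {R : realType} {m : nat}.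
Variables (psi : R -> R) (b : nat -> R).
Local Notation S := (sphere R m.+1).
Local Notation k := (isotropic m.+1 psi).
Hypothesis b0 : forall j, 0 <= b j.
Hypothesis psiE : forall t, `|t| <= 1 ->
  (fun J => \sum_(j < J) b j * t ^+ j) @ \oo --> psi (acos t).

(* The combinations [sum_i v_i (delta_{x_i} + s delta_{-x_i})] with [s = (-1)^p]
   kill the monomials whose degree does not have parity [p]; those of the
   other parity and of degree at most [N] are killed by the choice of [v]. *)
Lemma not_infinitely_many_parity_null : ~ infinitely_many_parity b ->
  exists (T : finType) (a : T -> R) (x : T -> S),
    [/\ injective x, exists s, a s != 0, \sum_s a s = 0 &
      gram k (combination a x) (combination a x) = 0].
Proof.
move=> /existsNP[p /existsNP[N bN]].
have bz j : (N <= j)%N -> odd j = p -> b j = 0.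
  move=> Nj oj; apply/eqP; rewrite eq_le b0 andbT leNgt; apply/negP => bj.
  by apply: bN; exists j; split.
have [n [v [[i vi] vw]]] := @annihilating_weights R m N.
pose a (q : 'I_n * bool) := v q.1 * (-1) ^+ (q.2 && p).
have pw w : pairing (monomial w) (combination a (@antipodal_point R m n)) =
    (1 + (-1) ^+ (p (+) odd (size w))) *
    \sum_i v i * monomial w (antipodal_point (i, false)).
  rewrite pairing_combination -(pair_bigA _ (fun j c =>
    a (j, c) * monomial w (antipodal_point (j, c)))) mulr_sumr.
  apply: eq_bigr => j _; rewrite big_bool /= /a /= [monomial _ _ in X in X + _]monomial_antipodal /=.
  by rewrite signr_addb; ring.
exists ('I_n * bool)%type, a, (@antipodal_point R m n); split.
- exact: antipodal_point_inj.
- by exists (i, false); rewrite /a /= mulr1.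
(* The total mass is the pairing with the empty monomial, whose degree 0 is at most [N]; so [v]
   kills it for either parity [p]. *)
- have := pw [::]; rewrite pairing_combination vw // mulr0 => a0; apply: etrans a0.
  by apply: eq_bigr => q _; rewrite /monomial big_nil mulr1.
- set u := combination _ _.
  suff z J : \sum_(j < J) b j * gram (dot_power j) u u = 0.
    have := @gram_isotropic_cvg _ _ _ _ psiE u.
    under eq_fun do rewrite z.
    by move=> /cvg_lim <- //; exact: lim_cst.
  rewrite big1 // => j _; have [jN|Nj] := ltnP j N.
    rewrite gram_dot_power big1 ?mulr0 // => w _.
    by rewrite pw vw ?mulr0 ?expr0n // size_codom card_ord ltnW.
  have [oj|oj] := eqVneq (odd j) p; first by rewrite bz ?mul0r.
  rewrite gram_dot_power big1 ?mulr0 // => w _.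
  rewrite pw size_codom card_ord (_ : p (+) odd j) ?expr1 ?subrr ?mul0r ?expr0n //.
  by move: oj; case: (p); case: (odd j).
Qed.

Lemma strictly_positive_definite_infinitely_many :
  strictly_positive_definite k -> infinitely_many_parity b.
Proof.
move=> spd; apply: contrapT => /not_infinitely_many_parity_null.
move=> [T [a [x [xinj [s as0] _ a0]]]].
by move: as0; rewrite (strictly_positive_definite_fin spd xinj a0) eqxx.
Qed.

End strictly_positive_definite_coefficients.

(** * Finitely supported probabilities and characteristic kernels *)

Lemma continuous_borel_measurable {R : realType} {X : ptopologicalType} (f : X -> R) :
  continuous f -> measurable_fun [set: borel X] (f : borel X -> R).
Proof.
move=> /continuousP fc; apply: (measurability _ (RGenOpens.measurableE R)).
move=> _ [_ [a [b ->] <-]]; rewrite setTI; apply: sub_sigma_algebra.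
exact/fc/interval_open.
Qed.

Section discrete_probability.
Context {R : realType} {dp : measure_display} {T : measurableType dp}.
Variables (u : seq (R * T)) (t0 : T).
Hypothesis u0 : forall p, p \in map fst u -> 0 <= p.
Hypothesis u1 : \sum_(p <- u) p.1 = 1.

(** The absolute value supplies the nonnegativity demanded by [mscale]; it changes no weight of
    [u]. *)
Let atom (i : nat) : {measure set T -> \bar R} :=
  mscale (`|(nth (0, t0) u i).1|)%:nng (\d_((nth (0, t0) u i).2)).

Let atoms : {measure set T -> \bar R} := msum atom (size u).

Let nth_norm i : (i < size u)%N -> `|(nth (0, t0) u i).1| = (nth (0, t0) u i).1.
Proof.
move=> iu; rewrite ger0_norm // u0 // -(nth_map _ 0) //.
by rewrite mem_nth // size_map.
Qed.

Let atomsE A : atoms A = (pairing (\1_A : T -> R) u)%:E.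
Proof.
rewrite /pairing (big_nth (0, t0)) big_mkord -sumEFin; apply: eq_bigr => i _.
have -> : atom i A = (`|(nth (0%R, t0) u i).1|%:E * \d_((nth (0%R, t0) u i).2) A)%E by [].
by rewrite nth_norm // diracE EFinM indicE.
Qed.

Let atoms_integral_ge0 (f : T -> R) : measurable_fun [set: T] f ->
  (forall x, 0 <= f x) -> (\int[atoms]_x (f x)%:E)%E = (pairing f u)%:E.
Proof.
move=> mf f0; rewrite ge0_integral_measure_sum //; last 2 first.
  by move=> x _; rewrite lee_fin.
  exact/measurable_EFinP.
rewrite /pairing (big_nth (0, t0)) big_mkord -sumEFin; apply: eq_bigr => i _.
rewrite ge0_integral_mscale //; [|exact/measurable_EFinP|by move=> x _; rewrite lee_fin].
rewrite integral_dirac //; last exact/measurable_EFinP.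
by rewrite diracT mul1e EFinM -[in RHS]nth_norm.
Qed.

Lemma discrete_probability : exists P : probability T R,
  (forall A, P A = (pairing (\1_A : T -> R) u)%:E) /\
  forall f, measurable_fun [set: T] f -> (\int[P]_x (f x)%:E)%E = (pairing f u)%:E.
Proof.
have a1 : atoms setT = 1%E.
  rewrite atomsE -u1; congr EFin; apply: eq_bigr => p _.
  by rewrite indicT mulr1.
(* The mass is already 1: normalization only provides the structure of a probability. *)
pose P : probability T R := mnormalize atoms (dirac t0).
have PE A : P A = atoms A.
  by rewrite /P /= /mnormalize a1 /= onee_eq0 /= invr1 mule1.
exists P; split=> [A|f mf]; first by rewrite PE atomsE.
rewrite (eq_measure_integral atoms) => [|A _ _]; last exact: PE.
rewrite integralE -[fun x => (f x)%:E]/(EFin \o f) funerpos funerneg.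
have posneg x : f x = f^\+ x - f^\- x by rewrite -[f in LHS]funrposBneg.
rewrite (atoms_integral_ge0 (measurable_funrpos mf) (funrpos_ge0 f)).
rewrite (atoms_integral_ge0 (measurable_funrneg mf) (funrneg_ge0 f)).
rewrite -EFinB; congr EFin; rewrite /pairing -sumrB; apply: eq_bigr => p _.
by rewrite -mulrBr -posneg.
Qed.

End discrete_probability.

Section characteristic_coefficients.
Context {R : realType} {m : nat}.
Variables (psi : R -> R) (b : nat -> R).
Local Notation S := (sphere R m.+1).
Local Notation k := (isotropic m.+1 psi : S -> S -> R).
Hypothesis b0 : forall j, 0 <= b j.
Hypothesis psiE : forall t, `|t| <= 1 ->
  (fun J => \sum_(j < J) b j * t ^+ j) @ \oo --> psi (acos t).

Lemma measurable_sphere_set1 (x : S) : measurable ([set x] : set (borel S)).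
Proof.
pose f (y : S) := \sum_i (sphere_coord i y + (-1) * sphere_coord i x) *
                         (sphere_coord i y + (-1) * sphere_coord i x).
have fc : continuous f.
  apply: continuous_polyfun; apply: polyfun_sum => i.
  by apply: polyfun_mul; apply: polyfun_add; (exact: polyfun_coord || exact: polyfun_cst).
have fm := continuous_borel_measurable fc.
have -> : [set x] = [set: borel S] `&` (f @^-1` [set 0]).
  apply/seteqP; split=> y /=.
    move=> ->; split=> //; rewrite /f big1 // => i _.
    by rewrite mulN1r subrr mul0r.
  move=> [_ fy]; apply/eqP; rewrite -dist_sphere_eq0; apply/eqP/(etrans _ fy).
  by apply: eq_bigr => i _; rewrite mulN1r expr2.
exact: fm.
Qed.

(* A null combination of total mass zero is, up to a factor, the difference of
   two distinct probability measures with the same image in the RKHS. *)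
Lemma characteristic_infinitely_many :
  characteristic k -> infinitely_many_parity b.
Proof.
move=> [_ _ [H [ip [Hk [Phi [PhiE Phi_inj]]]]]].
apply: contrapT => nb.
have [T [a [x [xinj [s as0] a0 k0]]]] :=
  @not_infinitely_many_parity_null _ m _ _ b0 psiE nb.
pose Z := \sum_t `|a t|.
have Z0 : 0 < Z.
  rewrite /Z (bigD1 s) //= ltr_pwDl ?normr_gt0 //.
  by apply: sumr_ge0 => t _.
(* For [e = 1] and [e = -1] these are twice the positive and negative parts of [a], divided by [Z].
   Each sums to 1 because [a] has total mass zero, and they differ by [2 / Z * a]. *)
pose w (e : R) t := (`|a t| + e * a t) / Z.
have w_ge0 e : `|e| = 1 -> forall t, 0 <= w e t.
  move=> e1 t; rewrite divr_ge0 ?(ltW Z0) //.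
  have : `|e * a t| = `|a t| by rewrite normrM e1 mul1r.
  by move=> ea; have := ler_norm (- (e * a t)); rewrite normrN ea; lra.
have w1 e : \sum_t w e t = 1.
  rewrite -mulr_suml big_split /= -mulr_sumr a0 mulr0 addr0 divff //.
  by rewrite gt_eqF.
pose u e : seq (R * borel S) := combination (w e) x.
have Pex e : `|e| = 1 -> exists P : probability (borel S) R,
    (forall A, P A = (pairing (\1_A : borel S -> R) (u e))%:E) /\
    forall f, measurable_fun [set: borel S] f ->
      (\int[P]_x (f x)%:E)%E = (pairing f (u e))%:E.
  move=> e1; apply: discrete_probability; first exact: (point : S).
    move=> p; rewrite -map_comp => /mapP[t _ ->] /=; exact: w_ge0.
  by rewrite /u /combination big_map big_enum /= w1.
have [P [PA Pf]] := Pex 1 (normr1 _).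
have [Q [QA Qf]] := Pex (-1) (normrN1 _).
have wB f : pairing f (u 1) - pairing f (u (-1)) =
    2 / Z * pairing f (combination a x).
  rewrite !pairing_combination -sumrB mulr_sumr; apply: eq_bigr => t _.
  by rewrite /w; field; rewrite gt_eqF.
have Hy y : H (k^~ y) by case: Hk.
have PhiP (P' : probability (borel S) R) v y :
    (forall f, measurable_fun [set: borel S] f ->
      (\int[P']_x (f x)%:E)%E = (pairing f v)%:E) ->
    Phi P' y = pairing (k^~ y) v.
  move=> P'f; have [HPhi /(_ _ (Hy y))[kint kE]] := PhiE P'.
  have [[_ _ _ ips _ _ _] _ rep] := Hk.
  have kyE x' : ip (k^~ y) (k^~ x') = k x' y by rewrite -rep.
  have mk : measurable_fun [set: borel S] (k^~ y).
    apply/measurable_EFinP; have := measurable_int _ kint.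
    by congr measurable_fun; apply/funext => x'; rewrite /= kyE.
  rewrite (rep _ y) // ips //; apply: EFin_inj; rewrite kE -P'f //.
  by apply: eq_integral => x' _; rewrite kyE.
have PhiPQ : Phi P = Phi Q.
  apply/funext => y; rewrite (PhiP _ _ _ Pf) (PhiP _ _ _ Qf); apply/eqP.
  by rewrite -subr_eq0 wB (rkhs_null_combination Hk k0) ?mulr0.
have := Phi_inj _ _ PhiPQ _ (measurable_sphere_set1 (x s)).
rewrite PA QA => -[] /eqP; rewrite -subr_eq0 wB pairing_combination.
rewrite (bigD1 s) //= big1 => [|t ts].
  rewrite indicE mem_set // mulr1 addr0 mulf_eq0 (negPf as0) orbF.
  by rewrite gt_eqF // divr_gt0.
rewrite indicE memNset ?mulr0 // => /xinj E.
by rewrite E eqxx in ts.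
Qed.

End characteristic_coefficients.

(** * Continuous functions determine Borel probabilities on the sphere *)

Section sphere_probability.
Context {R : realType} {d : nat}.
Local Notation S := (sphere R d).
Implicit Types (P Q : probability (borel S) R) (f g : S -> R).

Lemma continuous_integrable P f : continuous f ->
  P.-integrable [set: borel S] (EFin \o (f : borel S -> R)).
Proof.
move=> fc; apply: measurable_bounded_integrable => //.
- by rewrite (le_lt_trans (probability_le1 _ _)) // ltry.
- exact: continuous_borel_measurable.
- have [M fM] := sphere_bounded fc; exists M; split; first exact: num_real.
  by move=> N MN x _; rewrite /= (le_trans (fM x)) // ltW.
Qed.

Lemma Rintegral_dist_le P f g e : continuous f -> continuous g ->
  (forall x, `|f x - g x| <= e) ->
  `|\int[P]_(x in [set: borel S]) f x - \int[P]_(x in [set: borel S]) g x| <= e.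
Proof.
move=> fc gc fg; rewrite -RintegralB //; try exact: continuous_integrable.
have fgc : continuous (fun x => f x - g x).
  by move=> x; exact: (continuousB (fc x) (gc x)).
apply: (le_trans (le_normr_Rintegral measurableT (continuous_integrable P fgc))).
have -> : e = \int[P]_(x in [set: borel S]) e.
  rewrite Rintegral_cst // -[LHS]mulr1; congr (_ * _); apply/esym.
  exact: (congr1 fine (@probability_setT _ _ _ P)).
apply: le_Rintegral => //.
- apply: (continuous_integrable P (f := fun x => `|f x - g x|)) => x.
  apply: (@continuous_comp S R R (fun x => f x - g x) Num.norm); first exact: fgc.
  exact: norm_continuous.
- by apply: (continuous_integrable P (f := fun=> e)) => x; exact: cst_continuous.
Qed.

Lemma closed_zero_set (C : set S) : closed C -> C !=set0 ->
  exists2 g : S -> R, continuous g &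
    (forall x, C x -> g x = 0) /\ (forall x, ~ C x -> 0 < g x).
Proof.
move=> Cc [c0 Cc0].
pose D (x y : S) : R := \sum_i `|sphere_coord i x - sphere_coord i y|.
have D0 x y : 0 <= D x y by apply: sumr_ge0 => i _.
pose V x := [set D x y | y in C].
have V0 x : V x !=set0 by exists (D x c0), c0.
have Vlb x : has_lbound (V x) by exists 0 => _ [y _ <-].
(* The distance to [C] in the sum norm of the coordinates; it is 1-Lipschitz for that distance. *)
pose g x := inf (V x).
have g_le x y : C y -> g x <= D x y by move=> Cy; apply: ge_inf => //; exists y.
have le_g x r : (forall y, C y -> r <= D x y) -> r <= g x.
  by move=> rD; apply: lb_le_inf => // _ [y Cy <-]; exact: rD.
have Dsym x y : D x y = D y x.
  by apply: eq_bigr => i _; rewrite distrC.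
have Dtri x y z : D x z <= D x y + D y z.
  rewrite -big_split; apply: ler_sum => i _ /=.
  by rewrite -(subrKA (sphere_coord i y)) ler_normD.
have g_lip x y : `|g x - g y| <= D x y.
  have le x' y' : g x' - D x' y' <= g y'.
    apply: le_g => z Cz; rewrite lerBlDr; apply: le_trans (g_le x' z Cz) _.
    by rewrite addrC; exact: Dtri.
  by rewrite ler_norml; have := le x y; have := le y x; rewrite (Dsym y x); lra.
have DC x : D x y @[y --> x] --> 0.
  rewrite -[X in _ --> X](_ : D x x = 0); last first.
    by rewrite /D big1 // => i _; rewrite subrr normr0.
  apply: (@cvg_sum R _ _ (nbhs x) _ _ _
    (fun i y => `|sphere_coord i x - sphere_coord i y|)) => i _.
  apply: (@cvg_norm _ _ _ (nbhs x)).
  apply: (@cvgB _ _ _ (nbhs x) _ (fun=> sphere_coord i x) (sphere_coord i)).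
    exact: cvg_cst.
  exact: continuous_sphere_coord.
exists g.
  move=> x; apply: (iffRL (@cvgrPdist_le _ R _ (nbhs x) _ g (g x))) => e e0.
  have /(@cvgrPdist_le _ R _ (nbhs x)) /(_ _ e0) := DC x.
  apply: filterS => y; rewrite sub0r normrN ger0_norm //.
  exact: le_trans.
split=> [x Cx|x nCx].
  apply/eqP; rewrite eq_le; apply/andP; split; last by apply: le_g => y _.
  by apply: (le_trans (g_le x x Cx)); rewrite /D big1 // => i _; rewrite subrr normr0.
have : nbhs x (~` C) by apply: open_nbhs_nbhs; split=> //; exact: closed_openC.
move=> /nbhs_ballP[e /= e0 eC]; apply: (lt_le_trans e0); apply: le_g => y Cy.
rewrite leNgt; apply/negP => De; apply: (eC y) => //.
apply: sphere_ball => // i; apply: le_lt_trans De.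
by rewrite /D (bigD1 i) //= lerDl sumr_ge0.
Qed.

(** Open sets are stable under intersection and generate the Borel sets. The indicator of an open
    set is the limit of [min(1, n g)], where [g] vanishes exactly on the complement. *)
Lemma probability_eq P Q :
  (forall f, continuous f ->
    \int[P]_(x in [set: borel S]) f x = \int[Q]_(x in [set: borel S]) f x) ->
  forall A : set (borel S), measurable A -> P A = Q A.
Proof.
move=> PQ.
have PQo (U : set S) : open U -> P (U : set (borel S)) = Q (U : set (borel S)).
  (* The whole space is treated apart: [closed_zero_set] requires a nonempty closed set. *)
  move=> oU; have [CU0|] := eqVneq (~` U) set0.
    have -> : U = [set: borel S] by rewrite -[U]setCK CU0 setC0.
    by apply: etrans (_ : 1%E = _); [|apply/esym]; exact: probability_setT.
  move=> /set0P/(closed_zero_set (open_closedC oU))[g gc [g0 g1]].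
  pose h (n : nat) x := Num.min 1 (n%:R * g x).
  have hc n : continuous (h n).
    move=> x; apply: (@continuous_min _ _ (fun=> 1) (fun x => n%:R * g x)).
      exact: cst_continuous.
    by apply: continuousM; [exact: cst_continuous|exact: gc].
  have g_ge0 x : 0 <= g x.
    by have [/g0 ->|/g1 /ltW] := pselect ((~` U) x).
  have h01 n x : 0 <= h n x <= 1.
    by rewrite /h le_min ler01 mulr_ge0 //= ge_min lexx.
  have mU : measurable (U : set (borel S)) by apply: sub_sigma_algebra.
  have hU (P' : probability (borel S) R) :
      (\int[P']_(x in [set: borel S]) (h n x)%:E)%E @[n --> \oo] -->
      P' (U : set (borel S)).
    have -> : P' (U : set (borel S)) = (\int[P']_(x in [set: borel S]) (\1_U x)%:E)%E.
      by rewrite integral_indic // setIT.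
    apply: (@dominated_cvg _ (borel S) R P' setT measurableT
      (fun n x => (h n x)%:E) (fun x => (\1_U x)%:E) (cst 1%E)).
    - by move=> n; apply/measurable_EFinP; exact: continuous_borel_measurable.
    - move=> x _; have [Ux|nUx] := pselect (U x).
        rewrite indicE mem_set //; apply: cvg_near_cst.
        have gx : 0 < g x by apply: g1; rewrite /setC /=; apply.
        have [N _ HN] := nbhs_infty_ger (g x)^-1.
        exists N => // n /= Nn; congr EFin; apply/min_idPl.
        by rewrite -ler_pdivrMr // mul1r; exact: HN.
      rewrite indicE memNset //; apply: cvg_near_cst; apply: nearW => n.
      by rewrite /h g0 // mulr0; congr EFin; apply/min_idPr; exact: ler01.
    - by [].
    - have := continuous_integrable P' (f := fun=> 1); apply.
      by move=> x; exact: cst_continuous.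
    - move=> n x _; rewrite /= lee_fin ger0_norm //; by case/andP: (h01 n x).
  have E n : (\int[P]_(x in [set: borel S]) (h n x)%:E)%E =
             (\int[Q]_(x in [set: borel S]) (h n x)%:E)%E.
    have fin (P' : probability (borel S) R) :
        (\int[P']_(x in [set: borel S]) (h n x)%:E)%E \is a fin_num.
      by apply: integrable_fin_num => //; exact: (continuous_integrable P' (hc n)).
    by rewrite -(fineK (fin P)) -(fineK (fin Q)); congr EFin; exact: (PQ _ (hc n)).
  have := hU P; under eq_fun do rewrite E; move=> /cvg_lim <- //.
  by have := hU Q => /cvg_lim <-.
move=> A mA; apply: (@measure_unique _ R (borel S) (@open S) (fun=> setT)) => //.
- by move=> U V; exact: openI.
- by move=> _; exact: openT.
- by rewrite bigcup_const.
- by move=> _; rewrite -ge0_fin_numE // fin_num_measure.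
Qed.

End sphere_probability.

(** * Kernel mean embeddings *)

Section kernel_mean.
Context {R : realType} {d : nat}.
Local Notation S := (sphere R d).
Implicit Types (P Q : probability (borel S) R).
Variables (k : S -> S -> R) (C : R).
Hypothesis kk : is_kernel k.
Hypothesis kc : continuous (fun p : S * S => k p.1 p.2).
Hypothesis kC : forall x, k x x <= C.

Definition kernel_mean (P : probability (borel S) R) : S -> R :=
  fun y => \int[P]_(x in [set: borel S]) k x y.

Lemma continuous_kernel_r y : continuous (k^~ y).
Proof.
rewrite (_ : k^~ y = kcomb k [:: (1, y)]); last first.
  by apply/funext => x; rewrite /kcomb pairing1.
exact: rkhs_continuous kk kc (rkhs_kcomb kk _).
Qed.

Lemma Rintegral_kcomb P u :
  \int[P]_(x in [set: borel S]) kcomb k u x = pairing (kernel_mean P) u.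
Proof.
elim: u => [|p u IH].
  rewrite pairing_nil; under eq_Rintegral do rewrite /kcomb pairing_nil.
  by rewrite Rintegral_cst // mul0r.
rewrite pairing_cons -IH -RintegralZl //; last first.
  by apply: continuous_integrable; exact: continuous_kernel_r.
rewrite -RintegralD //; first last.
- apply: continuous_integrable; exact: rkhs_continuous kk kc (rkhs_kcomb kk u).
- apply: (continuous_integrable P (f := fun x => p.1 * k x p.2)) => x.
  apply: (@continuousM R S (fun=> p.1) (k^~ p.2)); first exact: cst_continuous.
  exact: continuous_kernel_r.
by apply: eq_Rintegral => x _; rewrite /kcomb pairing_cons.
Qed.

Lemma rkhs_sup_le f x : rkhs k f -> f x ^+ 2 <= rkhs_sqnorm k f * C.
Proof.
move=> Hf; apply: (le_trans (rkhs_ptwise kk x Hf)).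
by rewrite ler_wpM2l // (rkhs_sqnorm_ge0 Hf).
Qed.

Let C0 : 0 <= C.
Proof.
apply: le_trans (kC point).
by have := gram_ge0 [:: (1, point)] kk; rewrite /gram pairing1 /kcomb pairing1.
Qed.

Lemma Rintegral_rkhs_sqr_le P f : rkhs k f ->
  (\int[P]_(x in [set: borel S]) f x) ^+ 2 <= rkhs_sqnorm k f * C.
Proof.
move=> Hf; have N0 := rkhs_sqnorm_ge0 Hf.
have fc : continuous f by exact: rkhs_continuous kk kc Hf.
have f0 x : `|f x - 0| <= Num.sqrt (rkhs_sqnorm k f * C).
  by rewrite subr0 -sqrtr_sqr ler_wsqrtr // rkhs_sup_le.
have zc : continuous ((fun=> 0) : S -> R) by move=> x; exact: cst_continuous.
have := Rintegral_dist_le P fc zc f0; rewrite Rintegral_cst // mul0r subr0 => le.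
rewrite -real_normK ?num_real // -[leRHS]sqr_sqrtr ?mulr_ge0 //.
by rewrite ler_pXn2r ?nnegrE ?sqrtr_ge0.
Qed.

(** Pairing the mean with [u] integrates [kcomb k u], which is bounded in supremum by its norm times
    the square root of [C]. *)
Lemma rkhs_kernel_mean P : rkhs k (kernel_mean P).
Proof.
apply: (rkhs_criterion kk C0) => u; rewrite -Rintegral_kcomb mulrC.
rewrite -(rkhs_sqnorm_kcomb kk); apply: Rintegral_rkhs_sqr_le; exact: (rkhs_kcomb kk).
Qed.

(** Both sides are continuous in [f] for the RKHS norm and agree on combinations of kernel
    sections. *)
Lemma rkhs_ip_kernel_mean P f : rkhs k f ->
  rkhs_ip k (kernel_mean P) f = \int[P]_(x in [set: borel S]) f x.
Proof.
move=> Hf; have Hm := rkhs_kernel_mean P.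
have fc : continuous f by exact: rkhs_continuous kk kc Hf.
apply/eqP; rewrite -subr_eq0 -normr_le0; apply/ler_addgt0Pr => e e0; rewrite add0r.
have e20 : 0 < e / 2 by rewrite divr_gt0.
have [dl dl0 mdl] := rkhs_ip_cont kk Hm Hf e20.
have C1 : 0 < C + 1 by rewrite ltr_wpDl.
have r0 : 0 < Num.min dl ((e / 2) ^+ 2 / (C + 1)).
  by rewrite lt_min dl0 divr_gt0 // exprn_gt0.
have [v] := rkhs_approx kk Hf r0; rewrite le_min => /andP[v1 v2].
have Hv := rkhs_kcomb kk v; have Hfv := rkhs_sub kk Hf Hv.
have I1 : `|\int[P]_(x in [set: borel S]) f x - pairing (kernel_mean P) v| <= e / 2.
  rewrite -Rintegral_kcomb -RintegralB //; last 2 first.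
  - exact: continuous_integrable.
  - by apply: continuous_integrable; exact: rkhs_continuous kk kc Hv.
  rewrite -(ler_pXn2r (ltn0Sn 1)) ?nnegrE ?normr_ge0 ?(ltW e20) //.
  rewrite real_normK ?num_real //; apply: (le_trans (Rintegral_rkhs_sqr_le P Hfv)).
  apply: (@le_trans _ _ (rkhs_sqnorm k (f \- kcomb k v) * (C + 1))).
    by rewrite ler_wpM2l ?lerDl ?ler01 // (rkhs_sqnorm_ge0 Hfv).
  by rewrite -ler_pdivlMr.
have I2 := mdl v v1; rewrite (splitr e) -(subrKA (pairing (kernel_mean P) v)).
by apply: (le_trans (ler_normD _ _)); rewrite lerD // distrC.
Qed.

Lemma pettis_kernel_mean P : is_pettis_integral (rkhs k) (rkhs_ip k) P
  (fun x : borel S => k^~ x) (kernel_mean P).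
Proof.
have [[_ _ _ ips _ _ _] _ rep] := moore_aronszajn kk.
split=> [|f Hf]; first exact: rkhs_kernel_mean.
have fc : continuous f by exact: rkhs_continuous kk kc Hf.
have fE : (fun x : borel S => rkhs_ip k f (k^~ x)) = f.
  by apply/funext => x; rewrite -rep.
split; first by rewrite fE; exact: continuous_integrable.
rewrite ips //; last exact: rkhs_kernel_mean.
rewrite rkhs_ip_kernel_mean // /Rintegral fineK.
  by apply: eq_integral => x _; rewrite -rep.
by apply: integrable_fin_num => //; exact: continuous_integrable.
Qed.

(** Equal means integrate every element of the RKHS equally, hence, by density, every continuous
    function. *)
Lemma kernel_mean_inj P Q :
  (forall f, continuous f -> forall e, 0 < e ->
    exists2 g, rkhs k g & forall x, `|f x - g x| < e) ->
  kernel_mean P = kernel_mean Q ->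
  forall A : set (borel S), measurable A -> P A = Q A.
Proof.
move=> dense PQ; apply: probability_eq => f fc.
apply/eqP; rewrite -subr_eq0 -normr_le0; apply/ler_addgt0Pr => e e0; rewrite add0r.
have e20 : 0 < e / 2 by rewrite divr_gt0.
have [g Hg fg] := dense f fc _ e20.
have gc : continuous g by exact: rkhs_continuous kk kc Hg.
have fg' x := ltW (fg x).
have IP := Rintegral_dist_le P fc gc fg'.
have := Rintegral_dist_le Q fc gc fg'.
rewrite -(rkhs_ip_kernel_mean Q Hg) -PQ rkhs_ip_kernel_mean // distrC => IQ.
rewrite (splitr e) -(subrKA (\int[P]_(x in [set: borel S]) g x)).
by apply: (le_trans (ler_normD _ _)); rewrite lerD.
Qed.

End kernel_mean.

Lemma isotropic_characteristic {R : realType} {d : nat} (psi : R -> R)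
    (b : nat -> R) :
  {within `[0, pi], continuous psi} -> is_kernel (isotropic d psi) ->
  (forall j, 0 <= b j) ->
  (forall t, `|t| <= 1 ->
    (fun J => \sum_(j < J) b j * t ^+ j) @ \oo --> psi (acos t)) ->
  infinitely_many_parity b -> characteristic (isotropic d psi).
Proof.
move=> psic kk b0 psiE bi.
have [f fc fE] := continuous_comp_acos psic.
have [C fC] : exists C, forall t, -1 <= t <= 1 -> `|f t| <= C.
  by apply: continuous_segment_bounded => //; lra.
have kE x y : isotropic d psi x y = f (dotp (val x) (val y)).
  by rewrite fE // dotp_le1.
have kC x y : `|isotropic d psi x y| <= C.
  by rewrite kE fC // -ler_norml dotp_le1.
have kc : continuous (fun p : sphere R d * sphere R d => isotropic d psi p.1 p.2).
  exact: continuous_isotropic.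
split; first by exists C.
(* Measurability refers to the product of the two Borel sigma-algebras, so it is obtained from
   coordinates on each factor rather than from joint continuity. *)
- rewrite (_ : (fun _ => _) = f \o (fun p : borel (sphere R d) * borel (sphere R d) =>
      \sum_i sphere_coord i p.1 * sphere_coord i p.2)); last first.
    by apply/funext => p /=; rewrite kE dotpE.
  apply: measurableT_comp; first exact: continuous_measurable_fun.
  apply: measurable_sum => i; apply: measurable_funM.
    apply: (measurableT_comp _ measurable_fst).
    by apply: continuous_borel_measurable; exact: continuous_sphere_coord.
  apply: (measurableT_comp _ measurable_snd).
  by apply: continuous_borel_measurable; exact: continuous_sphere_coord.
- have kCx x : isotropic d psi x x <= C by apply: le_trans (kC x x); exact: ler_norm.
  exists (rkhs (isotropic d psi)), (rkhs_ip (isotropic d psi)).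
  split; first exact: moore_aronszajn.
  exists (kernel_mean (isotropic d psi)); split=> [P|P Q PQ].
    exact: pettis_kernel_mean kCx P.
  apply: kernel_mean_inj kCx P Q _ PQ => // g gc e e0.
  have [h hp gh] := sphere_weierstrass gc e0.
  by exists h => //; exact: polyfun_rkhs hp.
Qed.

Theorem theorem4p6 (R : realType) (d : nat) (hd : (1 <= d)%N)
    (psi : R -> R) (hpsi : Psi_infty R psi)
    (k : sphere R d -> sphere R d -> R) (hk : k = isotropic d psi) :
  [/\ characteristic k <-> universal k,
      universal k <-> strictly_positive_definite k &
      strictly_positive_definite k <-> Psi_infty_plus R psi].
Proof.
have [b b0 psiE] := schoenberg hpsi.
have psic : {within `[0, pi], continuous psi} by case: (hpsi 1%N isT).
have kk n : (1 <= n)%N -> is_kernel (isotropic n psi) by move=> n1; case: (hpsi n n1).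
have MU n : (1 <= n)%N -> infinitely_many_parity b -> universal (isotropic n psi).
  by move=> n1; apply: isotropic_universal => //; exact: kk.
have US n : (1 <= n)%N -> universal (isotropic n psi) ->
    strictly_positive_definite (isotropic n psi).
  by move=> n1; apply: universal_strictly_positive_definite; exact: kk.
(* Writing [d] as a successor provides the two coordinates in which the circle lies. *)
have SM : strictly_positive_definite (isotropic d psi) -> infinitely_many_parity b.
  by case: d hd {k hk} => // m _; exact: strictly_positive_definite_infinitely_many.
have MC : infinitely_many_parity b -> characteristic (isotropic d psi).
  by apply: isotropic_characteristic => //; exact: kk.
have CM : characteristic (isotropic d psi) -> infinitely_many_parity b.
  by case: d hd {k hk SM MC} => // m _; exact: characteristic_infinitely_many.
rewrite hk; split; split.
- by move=> /CM; exact: MU.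
- by move=> /(US _ hd)/SM; exact: MC.
- exact: US.
- by move=> /SM; exact: MU.
(* The condition on [b], obtained on the sphere of dimension [d], is used here in every dimension
   [n]. *)
- by move=> /SM bi n n1; split; [exact: hpsi|exact/US/MU].
- by move=> /(_ d hd)[].
Qed.
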